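(* Let $(R,m,K)$ be a complete local domain (respectively, a standard graded $K$-algebra domain) of positive characteristic and Krull dimension $n\ge2$, and let $\overline{K}$ be the algebraic closure of $K$. Then there exists an element of $E_{R^+}(\overline{K})$ (respectively, of $E_{R^{+\mathrm{GR}}}(\overline{K})$) that is not killed by any power of $m$.
   Context: All rings are commutative with identity. In the complete local case, $R$ is a complete Noetherian local domain with maximal ideal $m$ and residue field $K$. In the graded case, $K$ is a field and $R=\bigoplus_{i\ge0}R_i$ is an $\mathbb{N}$-graded domain with $R_0=K$, finitely generated over $K$ by elements of degree $1$, and $m=\bigoplus_{i>0}R_i$ is the homogeneous maximal ideal. $R^+$ is the integral closure of $R$ in an algebraic closure of its fraction field. For an $\mathbb{N}$-graded domain $R$, $R^{+\mathrm{GR}}$ is a maximal direct limit of module-finite, $\mathbb{Q}_{\ge0}$-graded extension domains of $R$ (with gradings extending that of $R$); concretely, it is the subring of $R^+$ generated by the elements $f$ satisfying, for some $\delta\in\mathbb{Q}_{\ge0}$, a monic equation $f^t+r_1f^{t-1}+\cdots+r_t=0$ with each $r_i\in R$ zero or homogeneous of degree $i\delta$; such $f$ is homogeneous of degree $\delta$. $\overline{K}$ is the residue field of $R^+$ (resp. of $R^{+\mathrm{GR}}$ modulo its ideal of elements of positive degree), hence a module over that ring, and $E_B(\overline{K})$ denotes its injective hull as a $B$-module, for $B=R^+$ (resp. $B=R^{+\mathrm{GR}}$). These rings are in general not Noetherian. An element $v$ is not killed by any power of $m$ if $m^tv\ne0$ for every $t>0$. *)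

(* Defs.v *)
From HB Require Import structures.
From mathcomp Require Import all_boot all_order all_algebra.
From mathcomp Require Import boolp classical_sets.

Set Implicit Arguments.
Unset Strict Implicit.
Unset Printing Implicit Defensive.

Import Order.TTheory GRing.Theory Num.Theory.

Local Open Scope classical_set_scope.
Local Open Scope ring_scope.

(** * Ideals *)

Section Ideals.
Variable A : comNzRingType.
Implicit Types I J m : set A.

Definition is_ideal I :=
  [/\ I 0, (forall x y, I x -> I y -> I (x + y))
    & (forall a x, I x -> I (a * x))].

Definition ideal_gen (S : set A) : set A := smallest is_ideal S.

Definition prime_ideal I :=
  [/\ is_ideal I, ~ I 1 & forall x y, I (x * y) -> I x \/ I y].

Definition maximal_ideal I :=
  [/\ is_ideal I, ~ I 1
    & forall J, is_ideal J -> ~ J 1 -> I `<=` J -> J = I].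

Definition ideal_pow I (t : nat) : set A :=
  ideal_gen [set x | exists2 f : 'I_t -> A,
                       (forall i, I (f i)) & x = \prod_(i < t) f i].

Definition noetherian_ring :=
  forall I, is_ideal I -> exists s : seq A, I = ideal_gen [set` s].

Definition local_ring m :=
  maximal_ideal m /\ forall m', maximal_ideal m' -> m' = m.

Definition adic_cauchy I (x : nat -> A) :=
  forall t, exists N, forall i j, (N <= i)%N -> (N <= j)%N ->
    ideal_pow I t (x i - x j).

Definition adic_limit I (x : nat -> A) (l : A) :=
  forall t, exists N, forall i, (N <= i)%N -> ideal_pow I t (x i - l).

(* Separated and Cauchy-complete, i.e. [A -> lim_t A / I^t] is bijective. *)
Definition adically_complete I :=
  (forall x, (forall t, ideal_pow I t x) -> x = 0) /\
  (forall x, adic_cauchy I x -> exists l, adic_limit I x l).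

(* [P 0], ..., [P k] is a strictly increasing chain of primes, of length [k]. *)
Definition prime_chain (k : nat) (P : nat -> set A) :=
  (forall i, (i <= k)%N -> prime_ideal (P i)) /\
  (forall i, (i < k)%N -> P i `<` P i.+1).

Definition krull_dim (n : nat) :=
  (exists P, prime_chain n P) /\ (forall k P, prime_chain k P -> (k <= n)%N).

End Ideals.

Arguments noetherian_ring A : clear implicits.
Arguments krull_dim A n : clear implicits.

(* [pi : A -> k] identifies the field [k] with the quotient [A / I]. *)
Definition residue_field (A : comNzRingType) (k : fieldType) (I : set A)
    (pi : {rmorphism A -> k}) :=
  (forall y, exists x, pi x = y) /\ (forall x, I x <-> pi x = 0).

(** * Subrings *)

Definition is_subring (A : comNzRingType) (S : set A) :=
  [/\ S 1, (forall x y, S x -> S y -> S (x - y))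
    & (forall x y, S x -> S y -> S (x * y))].

Section GeneratedSubring.
Variables (A : comNzRingType) (G : set A).

Definition subring_gen : set A := smallest (@is_subring A) G.

Lemma subring_gen_subring : is_subring subring_gen.
Proof.
split; first by move=> S [[S1 _ _] _]; exact: S1.
- move=> x y hx hy S hS; have [[_ SB _] _] := hS.
  by apply: SB; [apply: hx | apply: hy].
- move=> x y hx hy S hS; have [[_ _ SM] _] := hS.
  by apply: SM; [apply: hx | apply: hy].
Qed.

Lemma sub_subring_gen x : G x -> subring_gen x.
Proof. by move=> Gx S [_ GS]; apply: GS. Qed.

Definition subring_gen_pred : {pred A} := fun x => `[< subring_gen x >].

Lemma subring_genP x : reflect (subring_gen x) (x \in subring_gen_pred).
Proof. exact: asboolP. Qed.

Lemma subring_gen_closed : subring_closed subring_gen_pred.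
Proof.
have [S1 SB SM] := subring_gen_subring.
split; first exact/subring_genP.
- by move=> x y /subring_genP hx /subring_genP hy; apply/subring_genP; apply: SB.
- by move=> x y /subring_genP hx /subring_genP hy; apply/subring_genP; apply: SM.
Qed.

HB.instance Definition _ :=
  GRing.isSubringClosed.Build A subring_gen_pred subring_gen_closed.

Record subring_gen_of := SubringGen
  { subring_val : A; _ : subring_val \in subring_gen_pred }.

HB.instance Definition _ := [isSub for subring_val].
HB.instance Definition _ := [Choice of subring_gen_of by <:].
HB.instance Definition _ := [SubChoice_isSubComNzRing of subring_gen_of by <:].

End GeneratedSubring.

(** * Absolute integral closure *)

(* The field extension [f : F -> L] is algebraic; with [L : closedFieldType]
   this says that [L] is an algebraic closure of [F]. *)
Definition algebraic_ext (F L : fieldType) (f : {rmorphism F -> L}) :=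
  forall x : L, algebraicOver f x.

Section AbsoluteIntegralClosure.
Variables (R : idomainType) (L : fieldType).
Variable (iota : {rmorphism {fraction R} -> L}).

Definition Rplus_pred : {pred L} :=
  fun x => `[< integralOver (iota \o @tofrac R) x >].

Lemma Rplus_predP x :
  reflect (integralOver (iota \o @tofrac R) x) (x \in Rplus_pred).
Proof. exact: asboolP. Qed.

Lemma Rplus_closed : subring_closed Rplus_pred.
Proof.
split; first by apply/Rplus_predP; exact: integral1.
- by move=> x y /Rplus_predP hx /Rplus_predP hy; apply/Rplus_predP; apply: integral_sub.
- by move=> x y /Rplus_predP hx /Rplus_predP hy; apply/Rplus_predP; apply: integral_mul.
Qed.

HB.instance Definition _ :=
  GRing.isSubringClosed.Build L Rplus_pred Rplus_closed.

Record Rplus := MkRplus { Rplus_val : L; _ : Rplus_val \in Rplus_pred }.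

HB.instance Definition _ := [isSub for Rplus_val].
HB.instance Definition _ := [Choice of Rplus by <:].
HB.instance Definition _ := [SubChoice_isSubComNzRing of Rplus by <:].

Lemma Rplus_incl_subproof (r : R) : iota (tofrac r) \in Rplus_pred.
Proof. by apply/Rplus_predP; exact: (integral_id (iota \o @tofrac R)). Qed.

Definition Rplus_incl (r : R) : Rplus := MkRplus (Rplus_incl_subproof r).

Lemma Rplus_incl_is_zmod : zmod_morphism Rplus_incl.
Proof. by move=> x y; apply: val_inj; rewrite /= !rmorphB. Qed.

Lemma Rplus_incl_is_monoid : monoid_morphism Rplus_incl.
Proof.
by split=> [|x y]; apply: val_inj; rewrite /= ?rmorph1 // !rmorphM.
Qed.

HB.instance Definition _ :=
  GRing.isZmodMorphism.Build R Rplus Rplus_incl Rplus_incl_is_zmod.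
HB.instance Definition _ :=
  GRing.isMonoidMorphism.Build R Rplus Rplus_incl Rplus_incl_is_monoid.

End AbsoluteIntegralClosure.

(** * Graded rings and the graded absolute integral closure *)

Record nat_grading (R : comNzRingType) := NatGrading {
  gr_part :> nat -> set R;
  gr_0 : forall i, gr_part i 0;
  gr_sub : forall i x y, gr_part i x -> gr_part i y -> gr_part i (x - y);
  gr_one : gr_part 0%N 1;
  gr_mul : forall i j x y,
    gr_part i x -> gr_part j y -> gr_part (i + j)%N (x * y);
  gr_span : forall x, exists (d : nat) (f : nat -> R),
    (forall i, gr_part i (f i)) /\ x = \sum_(0 <= i < d) f i;
  gr_direct : forall (d : nat) (f : nat -> R),
    (forall i, gr_part i (f i)) -> \sum_(0 <= i < d) f i = 0 ->
    forall i, (i < d)%N -> f i = 0 }.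

(* [\bigoplus_{i > 0} R_i] *)
Definition irrelevant_ideal (R : comNzRingType) (G : nat_grading R) : set R :=
  [set x | exists (d : nat) (f : nat -> R),
     (forall i, G i (f i)) /\ x = \sum_(1 <= i < d) f i].

(* [kappa] identifies [K] with [R_0], and [R] is generated as a ring over
   [R_0] by finitely many elements of [R_1]. *)
Definition standard_graded (K : fieldType) (R : comNzRingType)
    (kappa : {rmorphism K -> R}) (G : nat_grading R) :=
  (forall x, G 0%N x <-> exists c, kappa c = x) /\
  (exists s : seq R, (forall x, x \in s -> G 1%N x) /\
     subring_gen (G 0%N `|` [set` s]) = setT).

Section GradedAbsoluteIntegralClosure.
Variables (R : idomainType) (L : fieldType).
Variables (iota : {rmorphism {fraction R} -> L}) (G : nat_grading R).

(* [f^t + r_1 f^(t-1) + ... + r_t = 0] where each [r_i] is zero or homogeneous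
   of degree [i * delta]; as every [G d] contains [0], the alternative [r i = 0]
   matters only when [i * delta] is not a natural number. *)
Definition homogeneous_of_degree (delta : rat) (f : Rplus iota) :=
  exists (t : nat) (r : nat -> R),
    (forall i, (1 <= i <= t)%N ->
       r i = 0 \/ exists2 d : nat, d%:R = i%:R * delta & G d (r i)) /\
    f ^+ t + \sum_(1 <= i < t.+1) Rplus_incl iota (r i) * f ^+ (t - i) = 0.

Definition homogeneous : set (Rplus iota) :=
  [set f | exists2 delta : rat, 0 <= delta & homogeneous_of_degree delta f].

Definition RplusGR : Type := subring_gen_of homogeneous.

HB.instance Definition _ := GRing.ComNzRing.on RplusGR.
HB.instance Definition _ := SubType.on RplusGR.

Lemma homogeneous_incl d r : G d r -> homogeneous (Rplus_incl iota r).
Proof.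
move=> Gr; exists d%:R; first exact: ler0n.
exists 1%N, (fun=> - r); split.
  move=> i /andP[i0 i1]; right; exists d; last first.
    by rewrite -sub0r; apply: gr_sub => //; exact: gr_0.
  by have -> : i = 1%N by [apply/eqP; rewrite eqn_leq i0 i1]; rewrite mul1r.
by rewrite big_nat1 subnn expr0 expr1 mulr1 rmorphN subrr.
Qed.

Lemma RplusGR_incl_subproof (r : R) :
  Rplus_incl iota r \in subring_gen_pred homogeneous.
Proof.
have [d [f [hf ->]]] := gr_span G r.
rewrite rmorph_sum; apply: rpred_sum => i _.
by apply/subring_genP; apply: sub_subring_gen; apply: homogeneous_incl; exact: hf.
Qed.

Definition RplusGR_incl (r : R) : RplusGR :=
  SubringGen (RplusGR_incl_subproof r).

Lemma RplusGR_incl_is_zmod : zmod_morphism RplusGR_incl.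
Proof. by move=> x y; apply: val_inj; rewrite /= rmorphB. Qed.

Lemma RplusGR_incl_is_monoid : monoid_morphism RplusGR_incl.
Proof.
by split=> [|x y]; apply: val_inj; rewrite /= ?rmorph1 // rmorphM.
Qed.

HB.instance Definition _ :=
  GRing.isZmodMorphism.Build R RplusGR RplusGR_incl RplusGR_incl_is_zmod.
HB.instance Definition _ :=
  GRing.isMonoidMorphism.Build R RplusGR RplusGR_incl RplusGR_incl_is_monoid.

Definition RplusGR_positive : set RplusGR :=
  ideal_gen [set f : RplusGR | exists2 delta : rat,
               0 < delta & homogeneous_of_degree delta (subring_val f)].

End GradedAbsoluteIntegralClosure.

(** * Injective hulls *)

(* [k] regarded as a [B]-module by restriction of scalars along [pi]. *)
Definition restr_scalars (B k : comNzRingType) (pi : {rmorphism B -> k}) : Type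
  := k.

Section RestrScalars.
Variables (B k : comNzRingType) (pi : {rmorphism B -> k}).

HB.instance Definition _ := GRing.Zmodule.on (restr_scalars pi).

Let scale (b : B) (x : restr_scalars pi) : restr_scalars pi :=
  pi b * (x : k).

Lemma restr_scaleA a b x : scale a (scale b x) = scale (a * b) x.
Proof. by rewrite /scale rmorphM mulrA. Qed.

Lemma restr_scale1 : left_id 1 scale.
Proof. by move=> x; rewrite /scale rmorph1 mul1r. Qed.

Lemma restr_scaleDr : right_distributive scale +%R.
Proof. by move=> a x y; rewrite /scale mulrDr. Qed.

Lemma restr_scaleDl x : {morph scale^~ x : a b / a + b}.
Proof. by move=> a b; rewrite /scale rmorphD mulrDl. Qed.

HB.instance Definition _ := GRing.Zmodule_isLmodule.Build B (restr_scalars pi)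
  restr_scaleA restr_scale1 restr_scaleDr restr_scaleDl.

End RestrScalars.

Section InjectiveHull.
Variable B : comNzRingType.

Definition injective_module (E : lmodType B) :=
  forall (M N : lmodType B) (f : {linear M -> N}) (g : {linear M -> E}),
    injective f -> exists h : {linear N -> E}, forall x, h (f x) = g x.

Definition is_submodule (E : lmodType B) (N : set E) :=
  [/\ N 0, (forall x y, N x -> N y -> N (x + y))
    & (forall (b : B) x, N x -> N (b *: x))].

Definition essential (M E : lmodType B) (i : {linear M -> E}) :=
  forall N : set E, is_submodule N -> (exists2 x, N x & x <> 0) ->
    exists2 y : M, N (i y) & i y <> 0.

Definition injective_hull (M E : lmodType B) (i : {linear M -> E}) :=
  [/\ injective i, essential i & injective_module E].

End InjectiveHull.

(* [m^t v <> 0] for every [t > 0], where the ideals [m^t] of [R] act on the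
   [B]-module [E] through [incl : R -> B]. *)
Definition not_killed_by_powers (R B : comNzRingType)
    (incl : {rmorphism R -> B}) (m : set R) (E : lmodType B) (v : E) :=
  forall t : nat, (0 < t)%N ->
    exists2 r : R, ideal_pow m t r & incl r *: v <> 0.

(* Main.v *)
(* Let B be R^+ (resp. R^{+GR}), M the kernel of B -> Kbar, and suppose that x, y
   in B satisfy: y^t b in xB implies b in M. Put x_i = x^(1/2^i). By injectivity,
   a homomorphism from the ideal (x_0, x_1, ...) to E is of the form a |-> a v.
   As this ideal is an increasing union of principal ideals, such a homomorphism
   is a sequence w_i = x_{i+1} w_{i+1} in E, and at each step w_{i+1} may be
   changed by an element killed by x_{i+1} but not by y^{i+1}; so one can arrange
   y^i w_i <> 0, hence y^i v <> 0, for all i.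

   It remains to find x in R and y in m with this property. The point is that no
   power of y lies in xR, hence none in xR^+.
   Complete case: x and y come from a chain of primes of R, and R^+ is
   quasilocal because idempotents lift along R[T]/f -> K[T]/f.
   Graded case: counting dimensions in R gives x and y of degree 1. An equation
   y^t b = x c in R^{+GR} lifts to polynomials over L along T = 1, a variable
   recording the grading; comparing coefficients of degree t there gives
   y^t k = x c' with k the degree 0 part of b and c' in R^+. If b is not in M
   then k is a unit, so y^t would lie in xR^+. *)

Require Import Defs.
From HB Require Import structures.
From mathcomp Require Import all_boot all_order all_algebra.
From mathcomp Require Import boolp classical_sets.
From mathcomp Require Import ring zify.

Set Implicit Arguments.
Unset Strict Implicit.
Unset Printing Implicit Defensive.

Import Order.TTheory GRing.Theory Num.Theory.

Local Open Scope ring_scope.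

(** * Unbounded elements of injective modules *)

Section LinearRelation.
Variables (B : comNzRingType) (E : lmodType B).

(* A homomorphism from an ideal of [B] to [E], given by its graph. *)
Record linear_relation := LinearRelation {
  lrel :> B -> E -> Prop;
  lrelP : lrel 0 0 /\ forall c a w a' w',
    lrel a w -> lrel a' w' -> lrel (c * a + a') (c *: w + w') }.

Variable Gam : linear_relation.

Definition lrel_pred : {pred (B^o * E)%type} := fun u => `[< Gam u.1 u.2 >].

Lemma lrel_pred_closed : submod_closed lrel_pred.
Proof.
have [G0 GD] := lrelP Gam; split; first exact/asboolP.
by move=> c [a w] [a' w'] /asboolP /= h /asboolP /= h'; apply/asboolP/GD.
Qed.

HB.instance Definition _ :=
  GRing.isSubmodClosed.Build B (B^o * E)%type lrel_pred lrel_pred_closed.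

Record lrel_graph := LrelGraph
  { lrel_val : (B^o * E)%type; _ : lrel_val \in lrel_pred }.

HB.instance Definition _ := [isSub for lrel_val].
HB.instance Definition _ := [Choice of lrel_graph by <:].
HB.instance Definition _ := [SubChoice_isSubLmodule of lrel_graph by <:].

Definition lrel_fst (u : lrel_graph) : B^o := (lrel_val u).1.
Definition lrel_snd (u : lrel_graph) : E := (lrel_val u).2.

Fact lrel_fst_linear : linear lrel_fst. Proof. by []. Qed.
Fact lrel_snd_linear : linear lrel_snd. Proof. by []. Qed.

HB.instance Definition _ :=
  GRing.isLinear.Build B lrel_graph B^o _ lrel_fst lrel_fst_linear.
HB.instance Definition _ :=
  GRing.isLinear.Build B lrel_graph E _ lrel_snd lrel_snd_linear.

(** The first projection of the graph is injective, so the second one extends along it to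
    [h : B -> E], and [v] is [h 1]. *)
Lemma injective_relation : injective_module E ->
  (forall w, Gam 0 w -> w = 0) ->
  exists v : E, forall a w, Gam a w -> a *: v = w.
Proof.
move=> injE Gfun.
have fst_inj : injective lrel_fst.
  move=> u u' uu'; apply/eqP; rewrite -subr_eq0; apply/eqP.
  have /asboolP : lrel_val (u - u') \in lrel_pred by case: (u - u').
  have -> : (lrel_val (u - u')).1 = 0.
    by rewrite -[LHS]/(lrel_fst u - lrel_fst u') uu' subrr.
  move=> /Gfun d0; apply: val_inj; rewrite [RHS]raddf0; apply/eqP.
  rewrite -pair_eqE /pair_eq; apply/andP; split; last exact/eqP.
  by apply/eqP; rewrite -[LHS]/(lrel_fst u - lrel_fst u') uu' subrr.
have [h hE] := injE _ _ lrel_fst lrel_snd fst_inj.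
exists (h 1) => a w Gaw.
have Gaw' : ((a, w) : (B^o * E)%type) \in lrel_pred by apply/asboolP.
rewrite -[RHS]/(lrel_snd (LrelGraph Gaw')) -hE -linearZ.
by congr (h _); exact: mulr1.
Qed.

End LinearRelation.

Section Core.
Variables (B : comNzRingType) (k : fieldType) (pi : {rmorphism B -> k}).
Variables (E : lmodType B) (e : {linear restr_scalars pi -> E}).
Hypotheses (e_inj : injective e) (E_inj : injective_module E).

(** The homomorphism [a b |-> b w] on the principal ideal of [a] is well defined because [a] is
    regular. *)
Lemma injective_divisible (a : B) (w : E) :
  (forall b, a * b = 0 -> b = 0) -> exists v : E, a *: v = w.
Proof.
move=> areg.
pose G (x : B) (u : E) := exists2 b, x = a * b & u = b *: w.
have GP : G 0 0 /\ forall c x u x' u',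
    G x u -> G x' u' -> G (c * x + x') (c *: u + u').
  split; first by exists 0; rewrite ?mulr0 ?scale0r.
  move=> c x u x' u' [b -> ->] [b' -> ->]; exists (c * b + b').
    by ring.
  by rewrite scalerDl scalerA.
have [|v vP] := @injective_relation _ _ (LinearRelation GP) E_inj.
  by move=> u [b b0 ->]; rewrite (areg b) ?scale0r.
by exists v; apply: vP; exists 1; rewrite ?mulr1 ?scale1r.
Qed.

(** The map [y b + x c |-> e (pi b)] on the ideal generated by [x] and [y] is well defined by
    hypothesis; it kills [x] and sends [y] to [e 1]. *)
Lemma annihilated_by_not_by (x y : B) :
  (forall b c, y * b = x * c -> pi b = 0) ->
  exists2 w : E, x *: w = 0 & y *: w <> 0.
Proof.
move=> hxy.
pose G (a : B) (u : E) :=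
  exists b c, a = y * b + x * c /\ u = e (pi b : restr_scalars pi).
have GP : G 0 0 /\ forall c a u a' u',
    G a u -> G a' u' -> G (c * a + a') (c *: u + u').
  split.
    exists 0, 0; rewrite !mulr0 addr0 rmorph0; split=> //.
    by rewrite (linear0 e).
  move=> c a u a' u' [b [d [-> ->]]] [b' [d' [-> ->]]].
  exists (c * b + b'), (c * d + d'); split; first by ring.
  by rewrite -linearP rmorphD rmorphM.
have [|w wP] := @injective_relation _ _ (LinearRelation GP) E_inj.
  move=> u [b [c [/esym/eqP]]]; rewrite addr_eq0 -mulrN => /eqP/hxy -> ->.
  exact: (linear0 e).
exists w.
  have -> : x *: w = e (pi 0 : restr_scalars pi).
    by apply: wP; exists 0, 1; rewrite mulr0 add0r mulr1.
  by rewrite rmorph0; exact: (linear0 e).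
have -> : y *: w = e (pi 1 : restr_scalars pi).
  by apply: wP; exists 1, 0; rewrite mulr0 addr0 mulr1.
move=> h; have : (pi 1 : restr_scalars pi) = 0.
  by apply: e_inj; rewrite h (linear0 e).
by rewrite rmorph1 => /eqP; rewrite oner_eq0.
Qed.

Lemma exists_unbounded_element (x : nat -> B) (y : B) :
  (forall i, x i = x i.+1 ^+ 2) ->
  (forall i b, x i * b = 0 -> b = 0) ->
  (forall t b c, y ^+ t * b = x 0%N * c -> pi b = 0) ->
  exists v : E, forall t, y ^+ t *: v <> 0.
Proof.
move=> xS xreg hxy.
have x_root i : x 0%N = x i ^+ (2 ^ i).
  elim: i => [|i IHi]; first by rewrite expr1.
  by rewrite IHi xS -exprM expnS.
(* Raising to the power [2 ^ i] turns a relation for [x i] into one for [x 0], with [b ^+ (2 ^ i)]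
   in place of [b]. *)
have hxy' i t b c : y ^+ t * b = x i * c -> pi b = 0.
  move=> h; have : y ^+ (t * 2 ^ i) * b ^+ (2 ^ i) = x 0%N * c ^+ (2 ^ i).
    by rewrite exprM -exprMn h exprMn -x_root.
  move/hxy; rewrite rmorphXn => /eqP; rewrite expf_eq0 => /andP[_ /eqP//].
have step (iw : nat * E) :
    exists w', x iw.1.+1 *: w' = iw.2 /\ y ^+ iw.1.+1 *: w' <> 0.
  case: iw => i w /=.
  have [w1 w1E] := injective_divisible w (xreg i.+1).
  have [w2 xw2 yw2] := annihilated_by_not_by (hxy' i.+1 i.+1).
  have [yw1|] := pselect (y ^+ i.+1 *: w1 = 0); last by exists w1.
  by exists (w1 + w2); rewrite !scalerDr w1E xw2 addr0 yw1 add0r.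
have [nxt nxtP] := choice step.
pose w := fix w i := if i is j.+1 then nxt (j, w j)
                     else e (1 : restr_scalars pi).
have wS i : x i.+1 *: w i.+1 = w i by have [] := nxtP (i, w i).
have yw i : y ^+ i *: w i <> 0.
  case: i => [|i]; last by have [] := nxtP (i, w i).
  rewrite expr0 scale1r -(linear0 e) => /e_inj h.
  by have /eqP := (h : 1 = 0 :> k); rewrite oner_eq0.
(* Elements given at indices [i] and [j] are both moved up to [i + j], where they can be added. *)
have chain i n : exists2 z, x i = x (i + n)%N * z & w i = z *: w (i + n)%N.
  elim: n => [|n [z xz wz]].
    by rewrite addn0; exists 1; rewrite ?mulr1 ?scale1r.
  exists (x (i + n).+1 * z); rewrite addnS; first by rewrite xz xS; ring.
  by rewrite wz -wS scalerA mulrC.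
pose G (a : B) (u : E) := exists i b, a = x i * b /\ u = b *: w i.
have GP : G 0 0 /\ forall c a u a' u',
    G a u -> G a' u' -> G (c * a + a') (c *: u + u').
  split; first by exists 0%N, 0; rewrite mulr0 scale0r.
  move=> c a u a' u' [i [b [-> ->]]] [j [d [-> ->]]].
  have [z -> ->] := chain i j; have [z' -> ->] := chain j i.
  exists (i + j)%N, (c * z * b + z' * d); rewrite [(j + i)%N]addnC.
  by split; [ring | rewrite scalerDl !scalerA; congr (_ *: _ + _ *: _); ring].
have [|v vP] := @injective_relation _ _ (LinearRelation GP) E_inj.
  by move=> u [i [b [/esym/xreg -> ->]]]; rewrite scale0r.
exists v => t ytv; apply: (yw t).
have <- : x t *: v = w t.
  by apply: vP; exists t, 1; rewrite mulr1 scale1r.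
by rewrite scalerA mulrC -scalerA ytv scaler0.
Qed.

End Core.

(** * Integral elements and adic topology *)

(** Multiplying an integral equation of degree [l] for [c] by [x ^+ l] turns each [x ^+ i * c ^+ i]
    into [y ^+ (t * i)]; every term except the leading [y ^+ (t * l)] keeps a factor [x]. *)
Lemma integral_dvd_exp (A C : comNzRingType) (j : {rmorphism A -> C})
    (x y : A) (t : nat) (c : C) :
  injective j -> integralOver j c -> j y ^+ t = j x * c ->
  exists k r, y ^+ k = x * r.
Proof.
move=> j_inj [p p_mon /eqP pc0] yxc; set l := (size p).-1.
have sp : size p = l.+1 by rewrite /l prednK // size_poly_gt0 monic_neq0.
have : j (\sum_(i < l.+1) p`_i * x ^+ (l - i) * y ^+ (t * i)) = 0.
  rewrite -[RHS](mulr0 (j x ^+ l)) -pc0.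
  rewrite (@horner_coef_wide _ l.+1) -?sp ?size_poly // sp.
  rewrite rmorph_sum mulr_sumr; apply: eq_bigr => i _.
  have il : (i <= l)%N by rewrite -ltnS.
  rewrite !rmorphM !rmorphXn coef_map /= exprM yxc exprMn.
  have -> : j x ^+ l = j x ^+ (l - i) * j x ^+ i by rewrite -exprD subnK.
  by ring.
rewrite -[X in _ = X](rmorph0 j) => /j_inj; rewrite big_ord_recr /=.
have -> : p`_l = 1 by rewrite -[RHS](monicP p_mon) lead_coefE.
rewrite subnn expr0 !mul1r addrC => /eqP; rewrite addr_eq0 => /eqP yE.
exists (t * l)%N, (- \sum_(i < l) p`_i * x ^+ (l - i).-1 * y ^+ (t * i)).
rewrite yE mulrN mulr_sumr; congr (- _); apply: eq_bigr => i _.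
have {1}-> : (l - i)%N = (l - i).-1.+1 by rewrite prednK // subn_gt0.
by rewrite exprS; ring.
Qed.

Section IdealPowers.
Variables (A : comNzRingType).
Implicit Types (I J : set A) (S : set A).

Lemma ideal_gen_ideal S : is_ideal (ideal_gen S).
Proof.
split; first by move=> J [[J0 _ _] _].
- by move=> a b ha hb J hJ; have [[_ JD _] _] := hJ; apply: JD; [exact: ha|exact: hb].
- by move=> a b hb J hJ; have [[_ _ JM] _] := hJ; apply: JM; exact: hb.
Qed.

Lemma sub_ideal_gen S a : S a -> ideal_gen S a.
Proof. by move=> Sa J [_]; apply. Qed.

Lemma ideal_pow_ideal I t : is_ideal (ideal_pow I t).
Proof. exact: ideal_gen_ideal. Qed.

Lemma idealN J (hJ : is_ideal J) a : J a -> J (- a).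
Proof. by have [_ _ JM] := hJ; move=> Ja; rewrite -mulN1r; apply: JM. Qed.

Lemma idealB J (hJ : is_ideal J) a b : J a -> J b -> J (a - b).
Proof.
by have [_ JD _] := hJ; move=> Ja Jb; apply: JD => //; apply: (idealN hJ).
Qed.

Lemma idealMr J (hJ : is_ideal J) a b : J a -> J (a * b).
Proof. by have [_ _ JM] := hJ; move=> Ja; rewrite mulrC; apply: JM. Qed.

Lemma ideal_sum J (hJ : is_ideal J) (T : Type) (r : seq T) (P : pred T)
    (F : T -> A) :
  (forall i, P i -> J (F i)) -> J (\sum_(i <- r | P i) F i).
Proof. have [J0 JD _] := hJ; move=> h; apply: (big_ind J) => //; exact: JD. Qed.

Lemma ideal_powM I s t a b :
  ideal_pow I s a -> ideal_pow I t b -> ideal_pow I (s + t) (a * b).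
Proof.
move=> ha hb; have Ist := ideal_pow_ideal I (s + t); have [I0 ID IM] := Ist.
(* Membership in [ideal_gen] quantifies over ideals, so [ha] is applied to the ideal of all [u] with
   [u * b] in the target; [hb] is used likewise, with a product of generators fixed. *)
refine (ha (fun u => ideal_pow I (s + t) (u * b)) _); split.
  split=> /=; first by rewrite mul0r.
  - by move=> u v hu hv; rewrite mulrDl; apply: ID.
  - by move=> u v hv; rewrite -mulrA; apply: IM.
move=> _ [f If ->] /=.
refine (hb (fun u => ideal_pow I (s + t) (\prod_(i < s) f i * u)) _); split.
  split=> /=; first by rewrite mulr0.
  - by move=> u v hu hv; rewrite mulrDr; apply: ID.
  - by move=> u v hv; rewrite mulrCA; apply: IM.
move=> _ [g Ig ->] /=; apply: sub_ideal_gen.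
exists (fun i => match split i with inl i' => f i' | inr i' => g i' end).
  by move=> i; case: (split i).
rewrite big_split_ord; congr (_ * _); apply: eq_bigr => i _.
  by rewrite (unsplitK (inl i)).
by rewrite (unsplitK (inr i)).
Qed.

Lemma ideal_pow0 I a : ideal_pow I 0 a.
Proof.
rewrite -[a]mul1r; apply: (idealMr (ideal_pow_ideal I 0)).
by apply: sub_ideal_gen; exists (fun=> 1); [case | rewrite big_ord0].
Qed.

Lemma ideal_powX I t a : I a -> ideal_pow I t (a ^+ t).
Proof.
by move=> Ia; apply: sub_ideal_gen; exists (fun=> a); rewrite // prodr_const card_ord.
Qed.

Lemma ideal_pow_leq I s t a : (t <= s)%N -> ideal_pow I s a -> ideal_pow I t a.
Proof.
move=> /subnKC <-; apply; split; first exact: ideal_pow_ideal.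
move=> _ [f If ->]; rewrite big_split_ord; apply: (idealMr (ideal_pow_ideal I t)).
by apply: sub_ideal_gen; exists (fun i => f (lshift _ i)).
Qed.

Lemma ideal_pow1 I a : is_ideal I -> ideal_pow I 1 a <-> I a.
Proof.
move=> hI; split; last by move=> Ia; rewrite -[a]expr1; apply: ideal_powX.
by apply; split=> // _ [f If ->]; rewrite big_ord1.
Qed.

End IdealPowers.

(** The partial sums of the geometric series in [a] converge to the inverse, and separatedness makes
    the product exactly 1. *)
Lemma adic_unit (A : comNzRingType) (I : set A) (a : A) :
  is_ideal I -> adically_complete I -> I a -> exists b, (1 - a) * b = 1.
Proof.
move=> hI [Isep Icpl] Ia; pose x n := \sum_(i < n) a ^+ i.
have xE n : (1 - a) * x n = 1 - a ^+ n.
  by rewrite -opprB mulNr -subrX1 opprB.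
have xD n k t : (t <= n)%N -> ideal_pow I t (x (n + k)%N - x n).
  move=> tn; rewrite /x big_split_ord /= [X in X - _]addrC addrK.
  apply: (ideal_sum (ideal_pow_ideal I t)) => i _.
  apply: (@ideal_pow_leq _ _ (n + i)); first exact: leq_trans (leq_addr _ _).
  exact: ideal_powX.
have xC t i j : (t <= i)%N -> (t <= j)%N -> ideal_pow I t (x i - x j).
  wlog ij : i j / (j <= i)%N.
    move=> wl ti tj; case/orP: (leq_total j i) => [|ij]; first by move/wl; apply.
    rewrite -opprB; apply: (idealN (ideal_pow_ideal I t)); exact: wl.
  by move=> _ tj; rewrite -(subnKC ij); apply: xD.
have [|l lP] := Icpl x; first by move=> t; exists t => i j; apply: xC.
exists l; apply/eqP; rewrite -subr_eq0; apply/eqP/Isep => t.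
have [N NP] := lP t; pose n := maxn N t.
have -> : (1 - a) * l - 1 = - ((1 - a) * (x n - l)) - a ^+ n.
  by rewrite mulrBr xE; ring.
have It := ideal_pow_ideal I t.
apply: (idealB It).
  by apply: (idealN It); rewrite mulrC; apply: (idealMr It); apply: NP; exact: leq_maxl.
by apply: (@ideal_pow_leq _ _ n); [exact: leq_maxr | exact: ideal_powX].
Qed.

(** * Lifting idempotents modulo a monic polynomial over an adically complete ring *)

Section IdempotentLifting.
Variables (A : comNzRingType) (I : set A).
Implicit Types (p q f e h r : {poly A}).

Definition coefs_in (J : set A) p := forall i, J p`_i.

Lemma coefs_inD J p q : is_ideal J ->
  coefs_in J p -> coefs_in J q -> coefs_in J (p + q).
Proof. by move=> [_ JD _] hp hq i; rewrite coefD; apply: JD. Qed.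

Lemma coefs_inN J p : is_ideal J -> coefs_in J p -> coefs_in J (- p).
Proof. by move=> hJ hp i; rewrite coefN; apply: (idealN hJ). Qed.

Lemma coefs_inB J p q : is_ideal J ->
  coefs_in J p -> coefs_in J q -> coefs_in J (p - q).
Proof. by move=> hJ hp hq; apply: coefs_inD => //; apply: coefs_inN. Qed.

Lemma coefs_inMr J p q : is_ideal J -> coefs_in J p -> coefs_in J (p * q).
Proof.
move=> hJ hp i; rewrite coefM; apply: (ideal_sum hJ) => k _.
exact: (idealMr hJ).
Qed.

Lemma coefs_in_powM s t p q :
  coefs_in (ideal_pow I s) p -> coefs_in (ideal_pow I t) q ->
  coefs_in (ideal_pow I (s + t)) (p * q).
Proof.
move=> hp hq i; rewrite coefM; apply: (ideal_sum (ideal_pow_ideal I _)) => k _.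
by apply: ideal_powM.
Qed.

(** Each step of long division by a monic [f] subtracts a multiple of the current leading
    coefficient, which lies in [J]. *)
Lemma coefs_in_divp J f q : is_ideal J -> f \is monic -> coefs_in J q ->
  exists h r, [/\ q = f * h + r, (size r < size f)%N & coefs_in J r].
Proof.
move=> hJ f_mon; have f_gt0 : (0 < size f)%N by rewrite size_poly_gt0 monic_neq0.
have [n] := ubnP (size q); elim: n q => // n IHn q qn hq.
have [qf|fq] := ltnP (size q) (size f).
  by exists 0, q; rewrite mulr0 add0r.
pose g := f * (lead_coef q *: 'X^(size q - size f)).
have gE i : g`_i = if (i < size q - size f)%N then 0
                  else lead_coef q * f`_(i - (size q - size f)).
  by rewrite /g -scalerAr coefZ coefMXn; case: ifP; rewrite ?mulr0.
have [||h [r [qgE rf hr]]] := IHn (q - g).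
- rewrite (leq_trans _ (qn : (size q <= n)%N)) //.
  rewrite -[size q]prednK ?(leq_trans f_gt0) // ltnS.
  apply/leq_sizeP => i; rewrite leq_eqVlt => /orP[/eqP <-|qi].
    have -> : (q - g)`_(size q).-1 = lead_coef q - lead_coef q * lead_coef f.
      rewrite coefB gE ifF; last by lia.
      by rewrite !lead_coefE; congr (_ - _ * _`__); lia.
    by rewrite (monicP f_mon) mulr1 subrr.
  have qi' : (size q <= i)%N by lia.
  rewrite coefB gE ifF; last by lia.
  rewrite [q`__]nth_default // [f`__]nth_default ?mulr0 ?subrr //.
  by move: fq qi'; move: (size q) (size f) => u v; lia.
- apply: coefs_inB => // i; rewrite gE; case: ifP => _.
    by have [] := hJ.
  by apply: (idealMr hJ); rewrite lead_coefE; apply: hq.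
exists (lead_coef q *: 'X^(size q - size f) + h), r; split=> //.
by rewrite mulrDr -addrA -qgE /g; ring.
Qed.

Lemma monic_rem_uniq f h r : f \is monic -> r = f * h ->
  (size r < size f)%N -> r = 0.
Proof.
move=> f_mon rE rf; apply/eqP; rewrite rE; apply: contraTT rf => fh0.
have h0 : h != 0 by apply: contraNneq fh0 => ->; rewrite mulr0.
rewrite -leqNgt rE size_monicM //.
by move: h0; rewrite -size_poly_gt0; move: (size f) (size h) => u v; lia.
Qed.

(** Idempotency in [(A / I ^ t)[X] / f]. *)
Definition idempotent_mod f t e :=
  exists h, coefs_in (ideal_pow I t) (e ^+ 2 - e - f * h).

(* Newton's iteration for [T ^ 2 - T], whose derivative [2 T - 1] squares to [1]
   modulo [T ^ 2 - T]. *)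
Lemma idempotent_mod_step f t e : f \is monic -> (0 < t)%N ->
  (size e < size f)%N -> idempotent_mod f t e ->
  exists e', [/\ (size e' < size f)%N, idempotent_mod f t.+1 e'
               & coefs_in (ideal_pow I t) (e' - e)].
Proof.
move=> f_mon t0 ef [h]; set r := (X in coefs_in _ X) => hr.
have It := ideal_pow_ideal I t.
have hs : coefs_in (ideal_pow I t) (r * (e *+ 2 - 1)) by apply: coefs_inMr.
(* The Newton correction is reduced modulo [f] to keep degrees bounded, as the passage to the limit
   requires. *)
have [k [s [sE sf hs']]] := coefs_in_divp It f_mon hs.
exists (e - s); split.
- by rewrite (leq_ltn_trans (size_polyD _ _)) // gtn_max size_polyN ef.
- have {sE} -> : s = r * (e *+ 2 - 1) - f * k by rewrite sE addrC addKr.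
  (* This quotient makes the new error exactly [r * r * (4 r - 3)], with coefficients in the power
     [t + t] of [I]; [t > 0] gives [t + 1 <= t + t]. *)
  exists (h - h * r *+ 4 + h * r ^+ 2 *+ 4
           + k * ((e - r * (e *+ 2 - 1)) *+ 2 + f * k - 1)).
  set R := (X in coefs_in _ X).
  have -> : R = r * r * (r *+ 4 - 3%:R) by rewrite /R /r; ring.
  apply: coefs_inMr; first exact: ideal_pow_ideal.
  move=> i; apply: (@ideal_pow_leq _ _ (t + t)); last exact: coefs_in_powM.
  by rewrite -addn1 leq_add2l.
- by rewrite addrAC subrr add0r; apply: coefs_inN.
Qed.

(** The Newton iterates have degree below that of [f] and converge coefficientwise. The remainder of
    [e ^+ 2 - e] modulo [f] then has its coefficients in every power of [I], so it vanishes. *)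
Lemma idempotent_lift f e0 : is_ideal I -> adically_complete I -> f \is monic ->
  (size e0 < size f)%N -> idempotent_mod f 1 e0 ->
  exists e, coefs_in I (e - e0) /\ exists h, e ^+ 2 - e = f * h.
Proof.
move=> hI [Isep Icpl] f_mon e0f id0.
(* The exponent is [n + 1] because the Newton step needs a positive one. *)
pose ok n (e : {poly A}) := (size e < size f)%N /\ idempotent_mod f n.+1 e.
have step (ne : nat * {poly A}) : exists e', ok ne.1 ne.2 ->
    ok ne.1.+1 e' /\ coefs_in (ideal_pow I ne.1.+1) (e' - ne.2).
  case: ne => n e /=; have [[ef ide]|] := pselect (ok n e); last by exists 0.
  by have [e' [? ? ?]] := idempotent_mod_step f_mon (ltn0Sn n) ef ide; exists e'.
have [nxt nxtP] := choice step.
pose e_ := fix e_ n := if n is n'.+1 then nxt (n', e_ n') else e0.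
have e_ok n : ok n (e_ n).
  by elim: n => // n IHn; have [] := nxtP (n, e_ n) IHn.
have e_S n : coefs_in (ideal_pow I n.+1) (e_ n.+1 - e_ n).
  by have [] := nxtP (n, e_ n) (e_ok n).
have e_D n k : coefs_in (ideal_pow I n.+1) (e_ (n + k)%N - e_ n).
  elim: k => [|k IHk].
    by rewrite addn0 subrr => i; rewrite coef0; have [] := ideal_pow_ideal I n.+1.
  rewrite addnS -[e_ _](subrK (e_ (n + k)%N)) -addrA.
  apply: coefs_inD => //; first exact: ideal_pow_ideal.
  move=> i; apply: (@ideal_pow_leq _ _ (n + k).+1); last exact: e_S.
  by rewrite ltnS leq_addr.
have e_C t i j : (t <= i)%N -> (t <= j)%N ->
    coefs_in (ideal_pow I t) (e_ i - e_ j).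
  wlog ij : i j / (j <= i)%N.
    move=> wl ti tj; case/orP: (leq_total j i) => [|ij]; first by move/wl; apply.
    rewrite -opprB; apply: coefs_inN; first exact: ideal_pow_ideal.
    exact: wl.
  move=> _ tj u; rewrite -(subnKC ij); apply: (@ideal_pow_leq _ _ j.+1).
    exact: leq_trans tj _.
  exact: e_D.
have lim_ex i : exists l, adic_limit I (fun n => (e_ n)`_i) l.
  apply: Icpl => t; exists t => u v tu tv; rewrite -coefB; exact: e_C.
have [l lP] := choice lim_ex; pose e := \poly_(i < size f) l i.
have e_e t : exists2 n, (t <= n)%N & coefs_in (ideal_pow I t) (e_ n - e).
  have [N NP] := choice (fun i => lP i t).
  exists (maxn t (\max_(i < size f) N i)); first exact: leq_maxl.
  move=> i; rewrite coefB coef_poly; case: ltnP => [fi|fi].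
    apply: NP; apply: leq_trans (leq_maxr _ _).
    exact: (@leq_bigmax _ (fun i : 'I_(size f) => N i) (Ordinal fi)).
  rewrite nth_default ?subr0; first by have [] := ideal_pow_ideal I t.
  by apply: leq_trans fi; apply: ltnW; case: (e_ok (maxn t (\max_(i < size f) N i))).
exists e; split.
  have [n n1 hn] := e_e 1%N; rewrite -[e](subrK (e_ n)) -addrA.
  move=> i; apply/(ideal_pow1 _ hI); apply: coefs_inD.
  - exact: ideal_pow_ideal.
  - by rewrite -opprB; apply: coefs_inN => //; exact: ideal_pow_ideal.
  - exact: (e_D 0%N n : coefs_in (ideal_pow I 1) _).
(* The power 0 of [I] is the whole ring, so this is plain division by [f]. *)
have [h0 [r0 [eE r0f _]]] :=
  coefs_in_divp (ideal_pow_ideal I 0) f_mon (fun i => @ideal_pow0 _ I (e ^+ 2 - e)`_i).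
exists h0; rewrite eE; suff -> : r0 = 0 by rewrite addr0.
apply/polyP => i; rewrite coef0; apply: Isep => t.
have It := ideal_pow_ideal I t.
have [n tn hn] := e_e t; have [_ [h hh]] := e_ok n.
have hq : coefs_in (ideal_pow I t) (r0 - f * (h - h0)).
  have -> : r0 - f * (h - h0) =
      (e_ n ^+ 2 - e_ n - f * h) - (e_ n - e) * (e_ n + e - 1).
    have -> : r0 = e ^+ 2 - e - f * h0 by rewrite eE addrC addKr.
    by ring.
  apply: coefs_inB => //; last exact: coefs_inMr.
  by move=> u; apply: (@ideal_pow_leq _ _ n.+1); rewrite // ltnW.
(* Dividing [r0 - f * (h - h0)] by [f] leaves a remainder with coefficients in [I ^ t], which is
   [r0] by uniqueness. *)
have [h' [r [qE rf hr]]] := coefs_in_divp It f_mon hq.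
suff -> : r0 = r by exact: hr.
apply/eqP; rewrite -subr_eq0; apply/eqP.
apply: (@monic_rem_uniq f (h - h0 + h')) => //.
  by move/eqP: qE; rewrite subr_eq => /eqP ->; ring.
by rewrite (leq_ltn_trans (size_polyD _ _)) // gtn_max size_polyN r0f.
Qed.

End IdempotentLifting.

(** * The absolute integral closure *)

Lemma poly_split (A : nzRingType) (p : {poly A}) :
  exists q, p = q * 'X + (p`_0)%:P.
Proof.
elim/poly_ind: p => [|p c _]; first by exists 0; rewrite coef0 mul0r add0r.
by exists p; rewrite coefD coefMX coefC add0r.
Qed.

Section AbsoluteClosure.
Variables (R : idomainType) (L : fieldType).
Variable (iota : {rmorphism {fraction R} -> L}).

Local Notation jL := (iota \o @tofrac R).

Lemma frac_incl_inj : injective jL.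
Proof. by move=> a b /fmorph_inj/eqP; rewrite tofrac_eq => /eqP. Qed.

Lemma Rplus_incl_inj : injective (Rplus_incl iota).
Proof. by move=> a b /(congr1 val) /frac_incl_inj. Qed.

Lemma Rplus_mul_eq0 (b c : Rplus iota) : b * c = 0 -> b = 0 \/ c = 0.
Proof.
move=> /(congr1 val) /eqP; rewrite /= mulf_eq0.
by case/orP => /eqP h; [left|right]; apply: val_inj.
Qed.

Lemma Rplus_integral (b : Rplus iota) : integralOver (Rplus_incl iota) b.
Proof.
have /Rplus_predP[p p_mon /eqP pb0] := valP b; exists p => //.
apply/eqP/val_inj; rewrite -[RHS]pb0 -horner_map -map_poly_comp.
by congr _.[_]; apply: eq_map_poly.
Qed.

End AbsoluteClosure.

(** [L] contains a root of [X^2 - a], and integrality is transitive. *)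
Lemma Rplus_sqrt (R : idomainType) (L : closedFieldType)
    (iota : {rmorphism {fraction R} -> L}) (a : Rplus iota) :
  exists b, b ^+ 2 = a.
Proof.
have [z zP] := solve_monicpoly (fun i => if i is 0%N then val a else 0) (ltn0Sn 1).
have z2 : z ^+ 2 = val a.
  by rewrite zP !big_ord_recl big_ord0 mul0r !addr0 expr0 mulr1.
have z_int : integralOver (iota \o @tofrac R) z.
  apply: (@integral_root_monic _ _ _ _ ('X^2 - (val a)%:P)).
  - exact: monicXnsubC.
  - by apply/eqP; rewrite !hornerE z2 subrr.
  - apply/integral_poly => i; rewrite coefB coefXn coefC.
    apply: integral_sub; first by case: eqP => _; [exact: integral1|exact: integral0].
    by case: eqP => _; [apply/Rplus_predP/valP | exact: integral0].
by exists (MkRplus (introT (Rplus_predP _ _) z_int)); apply: val_inj.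
Qed.

(** * Complete local domains *)

Section CompleteLocal.
Variables (R : idomainType) (m : set R).
Variables (K : fieldType) (rho : {rmorphism R -> K}).
Hypotheses (m_ideal : is_ideal m) (m_complete : adically_complete m).
Hypothesis (rhoP : residue_field m rho).

Lemma residue_poly_surj (q : {poly K}) : exists p, map_poly rho p = q.
Proof.
have [s sE] := choice rhoP.1.
exists (\poly_(i < size q) s q`_i); apply/polyP => i.
rewrite coef_map coef_poly; case: ltnP => [_|qi]; first exact: sE.
by rewrite [RHS]nth_default //; exact: (rmorph0 rho).
Qed.

Lemma coefs_in_residue (p : {poly R}) :
  coefs_in (ideal_pow m 1) p <-> map_poly rho p = 0.
Proof.
split=> [hp|/polyP hp i].
  apply/polyP => i; rewrite coef_map coef0; apply/rhoP.2.
  by have /(ideal_pow1 _ m_ideal) := hp i.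
apply/(ideal_pow1 _ m_ideal); apply/rhoP.2.
by rewrite -coef_map hp coef0.
Qed.

(** If [b] lifts the inverse of [rho a], then [a * b] is 1 minus an element of [m], hence a unit. *)
Lemma complete_unit (a : R) : ~ m a -> exists b, a * b = 1.
Proof.
move=> ma; have [b bE] := rhoP.1 (rho a)^-1.
have a0 : rho a != 0 by apply/eqP => /rhoP.2.
have : m (1 - a * b) by apply/rhoP.2; rewrite rmorphB rmorph1 rmorphM bE divff ?subrr.
case/(adic_unit m_ideal m_complete) => c; rewrite subKr => abc.
by exists (b * c); rewrite mulrA.
Qed.

Variables (L : fieldType) (iota : {rmorphism {fraction R} -> L}).
Variables (Kbar : fieldType) (j : {rmorphism K -> Kbar}).
Variable (pi : {rmorphism Rplus iota -> Kbar}).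
Hypothesis pi_incl : forall r, pi (Rplus_incl iota r) = j (rho r).

(* [R^+] is quasilocal. If [f] is a monic multiple of [X] annihilating [b], and
   [f = X ^ k * g] over [K] with [g 0 <> 0], then the idempotent of [K[X] / f]
   that is [0] at [0] and [1] on [g] lifts to [e]; as [R^+] is a domain and
   [b] reduces to a root of [g], [e b = 1], while [e 0] lies in [m]. *)
Lemma Rplus_unit (b : Rplus iota) : pi b <> 0 -> exists c, b * c = 1.
Proof.
move=> /eqP pb0; have [p p_mon /eqP pb] := Rplus_integral b.
set i := Rplus_incl iota in pb *.
have pi_map (q : {poly R}) : pi (map_poly i q).[b] = (map_poly j (map_poly rho q)).[pi b].
  rewrite -horner_map -!map_poly_comp; congr _.[_].
  by apply: eq_map_poly => r /=; exact: pi_incl.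
(* The extra factor [X] gives [f] the root 0 over [K], whence [k > 0] below. *)
have [f [f_mon fb f0]] : exists f, [/\ f \is monic, (map_poly i f).[b] = 0
    & root (map_poly rho f) 0].
  exists (p * 'X); rewrite monicMr ?monicX // !rmorphM /= !map_polyX.
  by rewrite rootE !hornerM !hornerX pb mul0r mulr0.
have [k [g]] := multiplicity_XsubC (map_poly rho f) 0.
rewrite monic_neq0 ?monic_map //= subr0 => g0 fE.
have k_gt0 : (0 < k)%N.
  by case: k fE => // fE; move: f0; rewrite fE expr0 mulr1 (negPf g0).
have gb : (map_poly j g).[pi b] = 0.
  have := pi_map f; rewrite fb rmorph0 fE rmorphM rmorphXn /= map_polyX hornerM.
  rewrite hornerXn => /esym/eqP; rewrite mulf_eq0 expf_eq0 (negPf pb0) andbF orbF.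
  by move=> /eqP.
have : coprimep ('X^k) g.
  by apply: coprimep_expl; rewrite coprimep_sym -['X]subr0 coprimep_XsubC.
case/Bezout_eq1_coprimepP => -[u v] /= uv.
(* The idempotent over [K] is [u X^k]: since [u X^k + v g = 1], its square minus itself is
   [- u v X^k g], a multiple of [f]. *)
have [e1 e1E] := residue_poly_surj (u * 'X^k).
have [h1 h1E] := residue_poly_surj (- (u * v)).
have m0 := @ideal_pow_ideal _ m 0.
have [q [e0 [e1q e0f _]]] :=
  coefs_in_divp m0 f_mon (fun i => @ideal_pow0 _ m e1`_i).
have e0E : e0 = e1 - f * q by rewrite e1q addrC addKr.
have id0 : idempotent_mod m f 1 e0.
  exists (h1 - e1 * q *+ 2 + f * q ^+ 2 + q); apply/coefs_in_residue.
  have -> : e0 ^+ 2 - e0 - f * (h1 - e1 * q *+ 2 + f * q ^+ 2 + q)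
            = e1 ^+ 2 - e1 - f * h1 by rewrite e0E; ring.
  rewrite !rmorphB rmorphXn !rmorphM /= e1E h1E fE.
  transitivity (u * 'X^k * (u * 'X^k + v * g - 1)); first by ring.
  by rewrite uv subrr mulr0.
have [e [e_e0 [h eh]]] := idempotent_lift m_ideal m_complete f_mon e0f id0.
have rho_e : map_poly rho e = u * 'X^k - map_poly rho f * map_poly rho q.
  apply/eqP; rewrite -subr_eq0 -e1E -rmorphM -!rmorphB -e0E; apply/eqP.
  by apply/coefs_in_residue => l; apply/(ideal_pow1 _ m_ideal).
have [e' eE] := poly_split e.
have m_e0 : m e`_0.
  apply/rhoP.2; rewrite -coef_map rho_e fE coefB mulrAC.
  by rewrite !coefMXn k_gt0 subr0.
pose eb := (map_poly i e).[b].
(* Both [f] and [g] vanish at [pi b], so the Bezout identity gives [u X^k] the value 1 there. *)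
have pi_eb : pi eb = 1.
  have fb' : (map_poly j (map_poly rho f)).[pi b] = 0.
    by rewrite -pi_map fb rmorph0.
  have := congr1 (fun P => (map_poly j P).[pi b]) uv.
  rewrite /= rmorph1 hornerC rmorphD hornerD (rmorphM _ v) hornerM gb mulr0 addr0.
  rewrite /eb pi_map rho_e rmorphB hornerD hornerN (rmorphM _ (map_poly rho f)).
  by rewrite hornerM fb' mul0r subr0.
have eb1 : eb = 1.
  have : eb * (eb - 1) = 0.
    have -> : eb * (eb - 1) = (map_poly i (e ^+ 2 - e)).[b].
      by rewrite rmorphB rmorphXn hornerD hornerN horner_exp -/eb; ring.
    by rewrite eh rmorphM hornerM fb mul0r.
  case/Rplus_mul_eq0 => [eb0|/eqP]; last by rewrite subr_eq0 => /eqP.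
  by move: pi_eb; rewrite eb0 rmorph0 => /esym/eqP; rewrite oner_eq0.
have [c cE] := adic_unit m_ideal m_complete m_e0.
(* Here [1 = e(b) = e'(b) b + e(0)], and [c] inverts [1 - e(0)]. *)
exists ((map_poly i e').[b] * i c); rewrite -[RHS](rmorph1 i) -cE rmorphM rmorphB rmorph1.
have ebE : eb = (map_poly i e').[b] * b + i e`_0.
  by rewrite /eb {1}eE rmorphD rmorphM /= map_polyX map_polyC !hornerE.
by rewrite mulrA -eb1 ebE addrK [b * _]mulrC.
Qed.

End CompleteLocal.

(** [Q] is an invariant carried along the roots: trivial in the complete case; in the graded case,
    being a root of [x] of 2-power order, which keeps the roots homogeneous. *)
Lemma iterated_sqrt (B : comNzRingType) (Q : B -> Prop) (x : B) :
  (forall a, Q a -> exists2 b, b ^+ 2 = a & Q b) -> Q x ->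
  exists x_ : nat -> B, [/\ x_ 0%N = x, forall i, x_ i = x_ i.+1 ^+ 2
                          & forall i, Q (x_ i)].
Proof.
move=> sqrtQ Qx.
have step a : exists b, Q a -> b ^+ 2 = a /\ Q b.
  have [Qa|] := pselect (Q a); last by exists 0.
  by have [b] := sqrtQ a Qa; exists b.
have [s sP] := choice step.
have Qi i : Q (iter i s x) by elim: i => //= i /sP[].
by exists (fun i => iter i s x); split=> // i; have [] := sP _ (Qi i).
Qed.

Lemma not_killed_by_powers_elt (A B : comNzRingType) (i : {rmorphism A -> B})
    (m : set A) (E : lmodType B) (y : A) (v : E) :
  m y -> (forall t, i y ^+ t *: v <> 0) -> not_killed_by_powers i m v.
Proof.
move=> my yv t _; exists (y ^+ t); first exact: ideal_powX.
by rewrite rmorphXn.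
Qed.

(** In a chain of primes, [x] is taken in [P 1] outside [P 0] and [y] in [P 2] outside [P 1]: no
    power of [y] lies in the prime [P 1], which contains all multiples of [x]. *)
Lemma complete_case (R : idomainType) (m : set R)
    (K : fieldType) (rho : {rmorphism R -> K}) (n : nat)
    (L : closedFieldType) (iota : {rmorphism {fraction R} -> L})
    (Kbar : fieldType) (j : {rmorphism K -> Kbar})
    (pi : {rmorphism Rplus iota -> Kbar})
    (E : lmodType (Rplus iota)) (e : {linear restr_scalars pi -> E}) :
  is_ideal m -> adically_complete m -> residue_field m rho ->
  krull_dim R n -> (2 <= n)%N ->
  (forall r, pi (Rplus_incl iota r) = j (rho r)) ->
  injective e -> injective_module E ->
  exists v : E, not_killed_by_powers (Rplus_incl iota) m v.
Proof.
move=> m_ideal m_complete rhoP [[P [P_prime P_lt]] _] n2 pi_incl e_inj injE.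
have [P0 _ _] := P_prime 0%N isT.
have [P1_ideal P1_1 P1_prime] := P_prime 1%N (ltnW n2).
have [P2 P2_1 _] := P_prime 2%N n2.
have [_ /existsNP[x /not_implyP[P1x P0x]]] := P_lt 0%N (ltnW n2).
have [_ /existsNP[y /not_implyP[P2y P1y]]] := P_lt 1%N n2.
(* Outside [m], [y] would be a unit in the proper ideal [P 2]. *)
have my : m y.
  apply: contrapT => /(complete_unit m_ideal m_complete rhoP)[b yb].
  by apply: P2_1; rewrite -yb mulrC; have [_ _] := P2; apply.
have x_neq0 : x <> 0 by move=> x0; apply: P0x; rewrite x0; have [] := P0.
have yx k r : y ^+ k <> x * r.
  move=> yxr; have : P 1%N (y ^+ k).
    by rewrite yxr mulrC; have [_ _] := P1_ideal; apply.
  elim: k {yxr} => [|k IHk]; first by rewrite expr0.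
  by rewrite exprS => /P1_prime[].
have [x_ [x_0 x_S _]] :=
  @iterated_sqrt _ (fun=> True) (Rplus_incl iota x)
    (fun a _ => let: ex_intro b bE := Rplus_sqrt a in ex_intro2 _ _ b bE I) I.
have x_neq i : x_ i <> 0.
  elim: i => [|i IHi]; last by move=> x0; apply: IHi; rewrite x_S x0 expr0n.
  by rewrite x_0 -(rmorph0 (Rplus_incl iota)) => /Rplus_incl_inj.
have [||v vP] := @exists_unbounded_element _ _ _ _ e e_inj injE x_
    (Rplus_incl iota y) x_S.
- by move=> i b /Rplus_mul_eq0[/x_neq|].
- move=> t b c; rewrite x_0 => ybxc; apply: contrapT.
  case/(Rplus_unit m_ideal m_complete rhoP pi_incl) => b' bb'.
  have [|k [r]] := @integral_dvd_exp _ _ (Rplus_incl iota) x y t (c * b')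
      (@Rplus_incl_inj _ _ _) (Rplus_integral _).
    by rewrite mulrA -ybxc -mulrA bb' mulr1.
  exact: yx.
by exists v; apply: not_killed_by_powers_elt vP.
Qed.

(** * Graded domains *)

Section Grading.
Variables (R : comNzRingType) (G : nat_grading R).

Lemma gr_opp i x : G i x -> G i (- x).
Proof. by move=> Gx; rewrite -sub0r; apply: gr_sub => //; exact: gr_0. Qed.

Lemma gr_add i x y : G i x -> G i y -> G i (x + y).
Proof. by move=> Gx Gy; rewrite -[y]opprK; apply: gr_sub => //; exact: gr_opp. Qed.

Lemma gr_sum i (T : Type) (r : seq T) (P : pred T) (F : T -> R) :
  (forall k, P k -> G i (F k)) -> G i (\sum_(k <- r | P k) F k).
Proof.
by move=> GF; apply: (big_ind (G i)) => //; [exact: gr_0 | exact: gr_add].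
Qed.

Lemma gr_exp i k x : G i x -> G (i * k)%N (x ^+ k).
Proof.
move=> Gx; elim: k => [|k IHk]; first by rewrite muln0 expr0; exact: gr_one.
by rewrite mulnS exprS; apply: gr_mul.
Qed.

(** A homogeneous decomposition is stored as a polynomial, whose value at 1 is the decomposed
    element. *)
Definition homogeneous_coefs (P : {poly R}) := forall i, G i P`_i.

Lemma homogeneous_coefs_uniq P Q : homogeneous_coefs P -> homogeneous_coefs Q ->
  P.[1] = Q.[1] -> P = Q.
Proof.
move=> GP GQ PQ; apply/eqP; rewrite -subr_eq0; apply/eqP/polyP => i; rewrite coef0.
have GD k : G k (P - Q)`_k by rewrite coefB; apply: gr_sub.
have := @gr_direct _ G (size (P - Q)) _ GD; rewrite big_mkord => GD0.
have [iD|Di] := ltnP i (size (P - Q)); last by rewrite nth_default.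
apply: GD0 => //; transitivity (P - Q).[1].
  by rewrite horner_coef; apply: eq_bigr => k _; rewrite expr1n mulr1.
by rewrite !hornerE PQ subrr.
Qed.

Lemma components_ex r : exists P, homogeneous_coefs P /\ P.[1] = r.
Proof.
have [d [f [Gf ->]]] := gr_span G r; exists (\poly_(i < d) f i); split.
  by move=> i; rewrite coef_poly; case: ifP => _; [exact: Gf | exact: gr_0].
rewrite (@horner_coef_wide _ d) ?size_poly // big_mkord; apply: eq_bigr => i _.
by rewrite coef_poly ltn_ord expr1n mulr1.
Qed.

(* The coaction [r_0 + r_1 + ... |-> r_0 + r_1 X + ...] of the grading. *)
Definition components (r : R) : {poly R} := projT1 (cid (components_ex r)).

Lemma componentsP r i : G i (components r)`_i.
Proof. by rewrite /components; case: cid => P []. Qed.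

Lemma components1 r : (components r).[1] = r.
Proof. by rewrite /components; case: cid => P []. Qed.

Lemma components_uniq P r : homogeneous_coefs P -> P.[1] = r -> components r = P.
Proof.
move=> GP Pr; apply: homogeneous_coefs_uniq => //; first exact: componentsP.
by rewrite components1 Pr.
Qed.

Lemma components_is_zmod : zmod_morphism components.
Proof.
move=> x y; apply: components_uniq => [i|].
  by rewrite coefB; apply: gr_sub; exact: componentsP.
by rewrite !hornerE !components1.
Qed.

Lemma components_hom d r : G d r -> components r = r *: 'X^d.
Proof.
move=> Gr; apply: components_uniq => [i|]; last by rewrite !hornerE expr1n mulr1.
by rewrite coefZ coefXn; case: eqP => [->|_]; rewrite ?mulr1 ?mulr0 //; exact: gr_0.
Qed.

Lemma components_is_monoid : monoid_morphism components.
Proof.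
split=> [|x y]; first by rewrite (components_hom (gr_one G)) scale1r.
apply: components_uniq => [i|]; last by rewrite hornerM !components1.
rewrite coefM; apply: gr_sum => k _; rewrite -{1}(subnKC (leq_ord k)).
by apply: gr_mul; exact: componentsP.
Qed.

HB.instance Definition _ :=
  GRing.isZmodMorphism.Build R {poly R} components components_is_zmod.
HB.instance Definition _ :=
  GRing.isMonoidMorphism.Build R {poly R} components components_is_monoid.

End Grading.

(** * Linear algebra over the base field *)

Section Span.
Variables (K : fieldType) (R : comNzRingType) (kappa : {rmorphism K -> R}).
Implicit Types S : set R.

Definition is_subspace S :=
  [/\ S 0, forall x y, S x -> S y -> S (x + y) & forall c x, S x -> S (kappa c * x)].

Definition kspan S : set R := smallest is_subspace S.

Lemma kspan_subspace S : is_subspace (kspan S).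
Proof.
split; first by move=> J [[J0 _ _] _].
- by move=> a b ha hb J hJ; have [[_ JD _] _] := hJ; apply: JD; [exact: ha|exact: hb].
- by move=> c b hb J hJ; have [[_ _ JM] _] := hJ; apply: JM; exact: hb.
Qed.

Lemma sub_kspan S x : S x -> kspan S x.
Proof. by move=> Sx J [_]; apply. Qed.

Lemma kspan_ind S (J : set R) x :
  is_subspace J -> (forall y, S y -> J y) -> kspan S x -> J x.
Proof. by move=> hJ SJ; apply. Qed.

Lemma kspanB S x y : kspan S x -> kspan S y -> kspan S (x - y).
Proof.
have [_ SD SM] := kspan_subspace S; move=> hx hy; apply: SD => //.
by rewrite -mulN1r -(rmorphN1 kappa); apply: SM.
Qed.

Lemma kspan_sum S (T : Type) (r : seq T) (P : pred T) (F : T -> R) :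
  (forall k, P k -> kspan S (F k)) -> kspan S (\sum_(k <- r | P k) F k).
Proof. by have [S0 SD _] := kspan_subspace S; apply: big_ind. Qed.

Lemma kspanM S1 S2 S3 x y :
  (forall a b, S1 a -> S2 b -> S3 (a * b)) ->
  kspan S1 x -> kspan S2 y -> kspan S3 (x * y).
Proof.
move=> S12 hx hy; have [I0 ID IM] := kspan_subspace S3.
apply: (kspan_ind (J := fun u => kspan S3 (u * y)) _ _ hx).
  split; first by rewrite mul0r.
  - by move=> u v hu hv; rewrite mulrDl; apply: ID.
  - by move=> c u hu; rewrite -mulrA; apply: IM.
move=> a Sa; apply: (kspan_ind (J := fun u => kspan S3 (a * u)) _ _ hy).
  split; first by rewrite mulr0.
  - by move=> u v hu hv; rewrite mulrDr; apply: ID.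
  - by move=> c u hu; rewrite mulrCA; apply: IM.
by move=> b Sb; apply: sub_kspan; apply: S12.
Qed.

Lemma kspan_family (J : finType) (F : J -> R) x :
  kspan [set F i | i in setT] x -> exists c : J -> K, x = \sum_i kappa (c i) * F i.
Proof.
pose comb x := exists c : J -> K, x = \sum_i kappa (c i) * F i.
move=> hx; apply: (kspan_ind (J := comb) _ _ hx).
  split; first by exists (fun=> 0); rewrite big1 // => i _; rewrite rmorph0 mul0r.
  - move=> _ _ [c ->] [d ->]; exists (fun i => c i + d i).
    by rewrite -big_split; apply: eq_bigr => i _; rewrite rmorphD mulrDl.
  - move=> a _ [c ->]; exists (fun i => a * c i).
    by rewrite mulr_sumr; apply: eq_bigr => i _; rewrite rmorphM mulrA.
move=> _ [i _ <-]; exists (fun j => (j == i)%:R).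
rewrite (bigD1 i) //= eqxx rmorph1 mul1r big1 ?addr0 // => j /negPf ->.
by rewrite rmorph0 mul0r.
Qed.

(** The coordinates of the [g i] form a matrix with more rows than columns; a nonzero vector of its
    left kernel gives [c]. *)
Lemma linear_dependence (I J : finType) (g : I -> R) (F : J -> R) :
  (#|J| < #|I|)%N -> (forall i, kspan [set F k | k in setT] (g i)) ->
  exists2 c : I -> K, exists i, c i != 0 & \sum_i kappa (c i) * g i = 0.
Proof.
move=> JI gF; have [a aE] := choice (fun i => kspan_family (gF i)).
pose A : 'M[K]_(#|I|, #|J|) := \matrix_(i, k) a (enum_val i) (enum_val k).
have kerA : kermx A != 0.
  rewrite -mxrank_eq0 mxrank_ker subn_eq0 -ltnNge.
  exact: leq_ltn_trans (rank_leq_col A) JI.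
have [v v0 vA] : exists2 v : 'rV[K]_#|I|, v != 0 & v *m A = 0.
  have [u u0] : exists u, row u (kermx A) != 0.
    apply/existsP; apply: contraNT kerA; rewrite negb_exists => /forallP h.
    apply/eqP/row_matrixP => u; rewrite row0.
    by have := h u; rewrite negbK => /eqP ->.
  by exists (row u (kermx A)) => //; rewrite -row_mul mulmx_ker row0.
exists (fun i => v 0 (enum_rank i)).
  have [i vi] : exists i, v 0 i != 0.
    apply/existsP; apply: contraNT v0; rewrite negb_exists => /forallP h.
    apply/eqP/rowP => i; have := h i; rewrite negbK => /eqP ->.
    by rewrite mxE.
  by exists (enum_val i); rewrite enum_valK.
under eq_bigr => i _ do rewrite aE mulr_sumr.
rewrite exchange_big /= big1 // => k _.
transitivity (kappa ((v *m A) 0 (enum_rank k)) * F k); last first.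
  by rewrite vA mxE rmorph0 mul0r.
rewrite mxE rmorph_sum mulr_suml (reindex _ (onW_bij _ (enum_val_bij I))) /=.
by apply: eq_bigr => i _; rewrite mxE !enum_rankK enum_valK rmorphM mulrA.
Qed.

End Span.

(** * Dimension of standard graded domains *)

Lemma horner_map_MXaddC (A B : comNzRingType) (g : {rmorphism A -> B}) p c b :
  (map_poly g (p * 'X + c%:P)).[b] = (map_poly g p).[b] * b + g c.
Proof. by rewrite rmorphD rmorphM /= map_polyX map_polyC !hornerE. Qed.

Section PrimeChain.
Variables (K : fieldType) (R : idomainType) (kappa : {rmorphism K -> R}).
Variables (Q1 Q2 : set R) (f1 f2 : R).
Hypotheses (Q1_prime : prime_ideal Q1) (Q2_prime : prime_ideal Q2).
Hypotheses (f1_neq0 : f1 <> 0) (Q1f1 : Q1 f1) (Q2f2 : Q2 f2) (Q1f2 : ~ Q1 f2).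
Hypothesis (Q12 : forall r, Q1 r -> Q2 r).

Let ev2 : {rmorphism {poly K} -> R} := horner_eval f2 \o map_poly kappa.

(** Write a polynomial as [h X + c]. If [c] is nonzero, its value is the unit [c] modulo [Q2], which
    contains [Q1]; otherwise [f2] cancels modulo [Q1] and induction applies to [h]. *)
Lemma ev2_notin_prime (h : {poly K}) : h != 0 -> ~ Q1 (ev2 h).
Proof.
have [I1 _ Q1M] := Q1_prime; have [I2 Q2_1 _] := Q2_prime.
elim/poly_ind: h => [|h c IHh]; first by rewrite eqxx.
have ev2E : ev2 (h * 'X + c%:P) = ev2 h * f2 + kappa c.
  exact: horner_map_MXaddC.
move=> hc; rewrite ev2E.
have [c0|c_neq0] := eqVneq c 0.
  rewrite c0 rmorph0 addr0 => /Q1M[|//]; apply: IHh.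
  by apply: contraNneq hc => ->; rewrite c0 mul0r add0r.
move/Q12 => Q2c; apply: Q2_1.
have : Q2 (kappa c).
  rewrite -[kappa c](addKr (ev2 h * f2)) addrC.
  by apply: (idealB I2) => //; have [_ _] := I2; apply.
by rewrite -(rmorph1 kappa) -(mulVf c_neq0) rmorphM; have [_ _] := I2; apply.
Qed.

(** Write a polynomial as [P X + h]. Modulo [Q1] its value at [f1] is [h(f2)], nonzero unless
    [h = 0]; in that case [f1] cancels in the domain [R]. *)
Lemma prime_chain_alg_indep (P : {poly {poly K}}) :
  P != 0 -> (map_poly ev2 P).[f1] <> 0.
Proof.
have [I1 _ _] := Q1_prime; have [I10 _ I1M] := I1.
elim/poly_ind: P => [|P h IHP]; first by rewrite eqxx.
rewrite horner_map_MXaddC => Ph Ph0; have [h0|/ev2_notin_prime] := eqVneq h 0; last first.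
  apply; rewrite  -[ev2 h](addKr ((map_poly ev2 P).[f1] * f1)) Ph0 addr0.
  by apply: (idealN I1); apply: I1M.
move: Ph0; rewrite h0 rmorph0 addr0 => /eqP; rewrite mulf_eq0.
case/orP => /eqP //; apply: IHP.
by apply: contraNneq Ph => ->; rewrite h0 mul0r add0r.
Qed.

End PrimeChain.

(** * Finiteness over [K[x]] and the choice of elements of degree 1 *)

Section StandardGraded.
Variables (K : fieldType) (R : idomainType) (kappa : {rmorphism K -> R}).
Variable (G : nat_grading R).
Hypothesis (G_std : standard_graded kappa G).

Lemma gr_kappa c : G 0%N (kappa c).
Proof. by apply/G_std.1; exists c. Qed.

Section Monomials.
Variables (n : nat) (u : 'I_n -> R).
Hypothesis (Gu : forall i, G 1%N (u i)).

Definition monomial (a : {ffun 'I_n -> nat}) := \prod_i u i ^+ a i.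
Definition mdegree (a : {ffun 'I_n -> nat}) := (\sum_i a i)%N.
Definition monomials d : set R := [set r | exists2 a, mdegree a = d & r = monomial a].

Lemma gr_monomial a : G (mdegree a) (monomial a).
Proof.
apply: (big_ind2 (fun d x => G d x)); first exact: gr_one.
  by move=> ? ? ? ?; apply: gr_mul.
by move=> i _; have := gr_exp (a i) (Gu i); rewrite mul1n.
Qed.

(** The elements all of whose components are combinations of monomials of the right degree form a
    subring containing the generators. *)
Lemma gr_kspan_monomials :
  subring_gen (G 0%N `|` [set u i | i in setT]) = setT ->
  forall d r, G d r -> kspan kappa (monomials d) r.
Proof.
move=> genR.
pose S : set R := fun r => forall d, kspan kappa (monomials d) (components G r)`_d.
have S_ker d : kspan kappa (monomials d) 0 by have [] := kspan_subspace kappa (monomials d).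
have S_hom d r : kspan kappa (monomials d) r -> G d r -> S r.
  move=> hr Gr e; rewrite (components_hom Gr) coefZ coefXn.
  by case: eqP => [->|_]; rewrite ?mulr1 ?mulr0.
have S_kappa c : kspan kappa (monomials 0) (kappa c).
  have [_ _ SM] := kspan_subspace kappa (monomials 0).
  rewrite -[kappa c]mulr1; apply: SM; apply: sub_kspan; exists [ffun=> 0%N].
    by rewrite /mdegree big1 // => i _; rewrite ffunE.
  by rewrite /monomial big1 // => i _; rewrite ffunE.
have S_subring : is_subring S.
  split.
  - by rewrite -(rmorph1 kappa); apply: S_hom (gr_kappa 1).
  - by move=> a b Sa Sb d; rewrite rmorphB coefB; apply: kspanB.
  - move=> a b Sa Sb d; rewrite rmorphM coefM; apply: kspan_sum => k _.
    apply: kspanM (Sa k) (Sb (d - k)%N) => _ _ [v vk ->] [w wk ->].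
    exists [ffun i => (v i + w i)%N].
      transitivity (mdegree v + mdegree w)%N; last first.
        by rewrite vk wk subnKC // leq_ord.
      rewrite /mdegree -big_split.
      by apply: eq_bigr => i _; rewrite ffunE.
    by rewrite /monomial -big_split; apply: eq_bigr => i _; rewrite ffunE exprD.
move=> d r Gr; have : subring_gen (G 0%N `|` [set u i | i in setT]) r by rewrite genR.
move/(_ S) => hS.
suff /hS/(_ d) : is_subring S /\ (G 0%N `|` [set u i | i in setT] `<=` S)%classic.
  by rewrite (components_hom Gr) coefZ coefXn eqxx mulr1.
split=> // x [/G_std.1[c <-]|[i _ <-]]; first exact: S_hom (gr_kappa c).
apply: (S_hom 1%N) => //; apply: sub_kspan; exists [ffun j => (j == i) : nat].
  rewrite /mdegree (bigD1 i) //= ffunE eqxx big1 // => j /negPf ji.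
  by rewrite ffunE ji.
rewrite /monomial (bigD1 i) //= ffunE eqxx expr1 big1 ?mulr1 // => j /negPf ji.
by rewrite ffunE ji.
Qed.

(* Modulo [x] only finitely many monomials survive, so [R] is a finite module
   over [K[x]]. *)
Variables (x : R) (k : nat).
Hypotheses (Gx : G 1%N x) (k_gt0 : (0 < k)%N).
Hypothesis (ux : forall i, exists r, u i ^+ k = x * r).
Hypothesis (genR : subring_gen (G 0%N `|` [set u i | i in setT]) = setT).

(** The index set has [(d + 1) k ^ n] elements, which is only linear in [d]; the later counting
    argument rests on this. *)
Definition reduced_family d (ia : 'I_d.+1 * {ffun 'I_n -> 'I_k}) : R :=
  x ^+ ia.1 * \prod_i u i ^+ ia.2 i.

(** Induction on the degree: a monomial with some exponent at least [k] is [x * b], and [b] may be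
    replaced by its component one degree lower. *)
Lemma gr_kspan_reduced d r :
  G d r -> kspan kappa [set reduced_family ia | ia in setT : set ('I_d.+1 * _)] r.
Proof.
elim/ltn_ind: d r => d IHd r /(gr_kspan_monomials genR) hr.
set Bas := (X in kspan _ X).
apply: (kspan_ind (J := kspan kappa Bas) _ _ hr); first exact: kspan_subspace.
move=> _ [a ad ->].
have [/forallP ak|] := boolP [forall i, (a i < k)%N].
  apply: sub_kspan; exists (ord0, [ffun i => Ordinal (ak i)]) => //.
  by rewrite /reduced_family expr0 mul1r; apply: eq_bigr => i _; rewrite ffunE.
rewrite negb_forall => /existsP[i]; rewrite -leqNgt => ka.
have [w wE] := ux i.
have [b bE] : exists b, monomial a = x * b.
  rewrite /monomial (bigD1 i) //= -(subnKC ka) exprD wE -!mulrA.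
  by eexists; reflexivity.
case: d => [|d] in IHd hr Bas ad *.
  move: ad; rewrite /mdegree (bigD1 i) //=.
  by move: ka k_gt0; lia.
have -> : monomial a = x * (components G b)`_d.
  have := components_hom (gr_monomial a); rewrite ad {1}bE rmorphM /=.
  rewrite (components_hom Gx) expr1 -scalerAl => /(congr1 (fun p : {poly R} => p`_d.+1)).
  by rewrite !coefZ coefXM coefXn eqxx mulr1 => <-.
apply: (@kspanM _ _ _ [set x] _ _ _ _ _ _ (IHd d (ltnSn d) _ (componentsP G b d))).
  move=> _ _ -> [[l v] _ <-]; exists (lift ord0 l, v) => //.
  by rewrite /reduced_family /= exprS mulrA.
exact: sub_kspan.
Qed.

End Monomials.

(** The elements [f1] and [f2] taken from the primes need not be homogeneous, so they are controlled
    by a degree bound, through the span of this set. *)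
Definition gr_le d : set R := [set r | exists2 e, (e <= d)%N & G e r].

Lemma gr_le_exists r : exists d, kspan kappa (gr_le d) r.
Proof.
exists (size (components G r)); rewrite -{2}[r](components1 G) horner_coef.
apply: kspan_sum => i _; rewrite expr1n mulr1; apply: sub_kspan.
by exists i; [exact: ltnW | exact: componentsP].
Qed.

Lemma kspan_mono (S S' : set R) r : (forall a, S a -> S' a) ->
  kspan kappa S r -> kspan kappa S' r.
Proof.
move=> SS' hr; apply: (kspan_ind (J := kspan kappa S') _ _ hr).
  exact: kspan_subspace.
by move=> a /SS'; apply: sub_kspan.
Qed.

Lemma gr_leM d d' r r' : kspan kappa (gr_le d) r -> kspan kappa (gr_le d') r' ->
  kspan kappa (gr_le (d + d')) (r * r').
Proof.
apply: kspanM => a b [e ed Ga] [e' ed' Gb]; exists (e + e')%N; first exact: leq_add.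
exact: gr_mul.
Qed.

Lemma gr_leX d r i : kspan kappa (gr_le d) r -> kspan kappa (gr_le (d * i)) (r ^+ i).
Proof.
move=> hr; elim: i => [|i IHi]; last by rewrite mulnS exprS; apply: gr_leM.
by apply: sub_kspan; exists 0%N; rewrite ?expr0 //; exact: gr_one.
Qed.

(* Otherwise [R] is finite over [K[x]], and counting the products
   [f1 ^+ i * f2 ^+ j] yields an algebraic relation between [f1] and [f2]. *)
Lemma exists_degree1_notin_radical (P : nat -> set R) (n : nat) (x : R) :
  prime_chain n P -> (2 <= n)%N -> G 1%N x ->
  exists2 y, G 1%N y & forall k r, y ^+ k <> x * r.
Proof.
move=> [P_prime P_lt] n2 Gx; apply: contrapT => /forall2NP yx.
have {}yx y : G 1%N y -> exists k r, y ^+ k = x * r.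
  move=> Gy; have [//|] := yx y.
  by move=> /existsNP[k /existsNP[r /contrapT]]; exists k, r.
have [s [Gs genR]] := G_std.2.
pose u (i : 'I_(size s)) := s`_i.
have Gu i : G 1%N (u i) by apply: Gs; apply: mem_nth.
have us : ([set u i | i in setT] = [set` s])%classic.
  apply/seteqP; split=> r /=; first by move=> [i _ <-]; apply: mem_nth.
  move=> rs; have rs' := rs; rewrite -index_mem in rs'.
  by exists (Ordinal rs') => //; rewrite /u nth_index.
rewrite -us in genR.
have [k_ k_P] := choice (fun i => yx (u i) (Gu i)).
(* One exponent for all generators; the successor makes it positive. *)
pose k := (\max_i k_ i).+1.
have ux i : exists r, u i ^+ k = x * r.
  have [r rE] := k_P i; exists (r * u i ^+ (k - k_ i)).
  by rewrite mulrA -rE -exprD subnKC // ltnW // ltnS; exact: leq_bigmax.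
have Q1 := P_prime 1%N (ltnW n2); have Q2 := P_prime 2%N n2.
have [_ /existsNP[f1 /not_implyP[P1f1 P0f1]]] := P_lt 0%N (ltnW n2).
have [P12 /existsNP[f2 /not_implyP[P2f2 P1f2]]] := P_lt 1%N n2.
have f1_neq0 : f1 <> 0.
  by move=> f10; apply: P0f1; rewrite f10; have [[]] := P_prime 0%N isT.
have [d [hf1 hf2]] : exists d, kspan kappa (gr_le d) f1 /\ kspan kappa (gr_le d) f2.
  have [d1 h1] := gr_le_exists f1; have [d2 h2] := gr_le_exists f2.
  exists (d1 + d2)%N; split; [move: h1 | move: h2]; apply: kspan_mono => a [e ed Ga];
    exists e => //; apply: (leq_trans ed); [exact: leq_addr | exact: leq_addl].
pose D := #|{: {ffun 'I_(size s) -> 'I_k}}|.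
(* [N] bounds the degree of [f1 ^+ i * f2 ^+ j] for [i, j <= T], and [T] is large enough that the
   [(T + 1) ^ 2] products outnumber the [(N + 1) * D] spanning elements. *)
pose T := ((d + d).+1 * D)%N; pose N := ((d + d) * T)%N.
pose g (ij : 'I_T.+1 * 'I_T.+1) := f1 ^+ ij.1 * f2 ^+ ij.2.
have gN ij : kspan kappa
    [set reduced_family u x ia | ia in
       setT : set ('I_N.+1 * {ffun 'I_(size s) -> 'I_k})] (g ij).
  set Bas := (X in kspan _ X).
  have hg : kspan kappa (gr_le N) (g ij).
    have := gr_leM (gr_leX (i := ij.1) hf1) (gr_leX (i := ij.2) hf2).
    apply: kspan_mono => a [e ed Ga].
    exists e => //; apply: (leq_trans ed); rewrite /N mulnDl.
    by apply: leq_add; apply: leq_mul => //; rewrite leq_ord.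
  apply: (kspan_ind (J := kspan kappa Bas) _ _ hg); first exact: kspan_subspace.
  move=> a [e eN Ga].
  have := gr_kspan_reduced Gu Gx (ltn0Sn _) ux genR Ga.
  apply: kspan_mono => _ [[l v] _ <-].
  by exists (widen_ord (eN : (e.+1 <= N.+1)%N) l, v).
have card_lt : (#|{: 'I_N.+1 * {ffun 'I_(size s) -> 'I_k}}| <
                #|{: 'I_T.+1 * 'I_T.+1}|)%N.
  have lt_sq (a b : nat) :
      ((a * (a.+1 * b)).+1 * b < (a.+1 * b).+1 * (a.+1 * b).+1)%N by nia.
  by rewrite !card_prod !card_ord; exact: lt_sq.
have [c [[i0 j0] c0] /= gc] := linear_dependence card_lt gN.
(* The outer variable stands for [f1], the inner one for [f2]. *)
pose Pc : {poly {poly K}} :=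
  \poly_(i < T.+1) \poly_(j < T.+1) c (inord i, inord j).
apply: (@prime_chain_alg_indep _ _ kappa (P 1%N) (P 2%N) f1 f2 Q1 Q2 f1_neq0 P1f1
  P2f2 P1f2 P12 Pc).
  apply: contraNneq c0 => /(congr1 (fun p : {poly {poly K}} => p`_i0`_j0)).
  by rewrite coef_poly ltn_ord inord_val coef_poly ltn_ord inord_val !coef0 => ->.
rewrite -[RHS]gc (@horner_coef_wide _ T.+1); last first.
  by apply: leq_trans (size_poly _ _) _; exact: size_poly.
transitivity (\sum_(i < T.+1) \sum_(j < T.+1) kappa (c (i, j)) * g (i, j)); last first.
  by rewrite pair_big; apply: eq_bigr => -[].
apply: eq_bigr => i _; rewrite coef_map coef_poly ltn_ord inord_val /=.
rewrite /horner_eval (@horner_coef_wide _ T.+1); last first.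
  by apply: leq_trans (size_poly _ _) _; exact: size_poly.
rewrite mulr_suml; apply: eq_bigr => j _.
by rewrite coef_map coef_poly ltn_ord inord_val /g /=; ring.
Qed.

End StandardGraded.

(** * The graded absolute integral closure *)

Lemma integral_equation (A C : comNzRingType) (g : {rmorphism A -> C})
    (t : nat) (r : nat -> A) (c : C) :
  c ^+ t + \sum_(1 <= i < t.+1) g (r i) * c ^+ (t - i) = 0 -> integralOver g c.
Proof.
(* The equation numbers its coefficients from the top, hence [r (t - k)] in degree [k]. *)
move=> eq0; exists ('X^t + \poly_(k < t) r (t - k)%N).
  by rewrite monicE lead_coefDl ?lead_coefXn // size_polyXn ltnS size_poly.
apply/eqP; rewrite -[RHS]eq0 rmorphD rmorphXn /= map_polyX hornerD hornerXn.
congr (_ + _); rewrite (@horner_coef_wide _ t); last first.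
  by rewrite (leq_trans (size_poly _ _)) // size_poly.
rewrite big_add1 big_nat_rev big_mkord /=; apply: eq_bigr => k _.
have kt := ltn_ord k; rewrite coef_map coef_poly kt /=.
by congr (g (r _) * _ ^+ _); lia.
Qed.

(** * Integrality over the coaction of the grading *)

Section Coaction.
Variables (R : idomainType) (L : closedFieldType).
Variables (iota : {rmorphism {fraction R} -> L}) (G : nat_grading R).

Local Notation jL := (iota \o @tofrac R).

(* [T] stands for an element of degree [1 / N]. *)
Definition coaction (N : nat) : {rmorphism R -> {poly L}} :=
  comp_poly 'X^N \o map_poly jL \o components G.

Lemma coaction_hom N d r : G d r -> coaction N r = jL r *: 'X^(N * d).
Proof.
move=> Gr; rewrite /coaction /= (components_hom Gr) map_polyZ map_polyXn.
by rewrite comp_polyZ comp_Xn_poly exprM.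
Qed.

Lemma coaction1 N r : (coaction N r).[1] = jL r.
Proof.
rewrite /coaction /= horner_comp hornerXn expr1n -[X in _.[X]](rmorph1 jL).
by rewrite horner_map components1.
Qed.

(** Substituting [T ^ M] for [T] refines the denominator [N] to [M * N]; this brings two lifts to a
    common denominator. *)
Lemma coaction_comp M N r : coaction N r \Po 'X^M = coaction (M * N) r.
Proof. by rewrite /coaction /= -comp_polyA comp_Xn_poly exprM. Qed.

Lemma integral_coaction_comp M N F :
  integralOver (coaction N) F -> integralOver (coaction (M * N)) (F \Po 'X^M).
Proof.
case=> p p_mon /rootP pF; exists p => //; apply/rootP.
rewrite -[RHS](rmorph0 (comp_poly 'X^M)) -pF -horner_map -map_poly_comp.
by congr _.[_]; apply: eq_map_poly => r /=; rewrite coaction_comp.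
Qed.

(* The grading of [RplusGR] is direct: specialisation at [T = 1] is injective on
   elements integral over the coaction. *)
Lemma integral_coaction_inj N F :
  integralOver (coaction N) F -> F.[1] = 0 -> F = 0.
Proof.
case=> p /monic_neq0 + /rootP + F1; have [-> //|F_neq0] := eqVneq F 0.
elim/poly_ind: p => [|p c IHp]; first by rewrite eqxx.
rewrite horner_map_MXaddC => pc_neq0 pcF.
have c0 : c = 0.
  apply: (@frac_incl_inj _ _ iota); rewrite rmorph0 -(coaction1 N).
  have := congr1 (fun P : {poly L} => P.[1]) pcF.
  by rewrite hornerD hornerM F1 mulr0 add0r horner0.
move: pcF; rewrite c0 rmorph0 addr0 => /eqP; rewrite mulf_eq0 (negPf F_neq0) orbF.
move=> /eqP; apply: IHp; apply: contraNneq pc_neq0 => ->.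
by rewrite c0 mul0r add0r.
Qed.

Lemma coaction_polyOver N r : coaction N r \is a polyOver (Rplus_pred iota).
Proof.
apply: polyOver_comp; last by rewrite rpredX ?polyOverX.
apply/polyOverP => i; rewrite coef_map /=; apply/Rplus_predP.
exact: (integral_id jL).
Qed.

(* For large [n] the monic polynomial [X ^ n - F] divides a monic polynomial with
   integral coefficients, so its roots, hence its coefficients, are integral. *)
Lemma integral_coaction_coef N F i :
  integralOver (coaction N) F -> integralOver jL F`_i.
Proof.
case=> p p_mon; set g := map_poly _ p => gF.
have g_mon : g \is monic by rewrite monic_map.
pose l := (size g).-1.
have sg : size g = l.+1 by rewrite prednK // size_poly_gt0 monic_neq0.
(* This [n] is large enough for [X ^ n] to dominate [F] and every coefficient of [g], so that
   [X ^ n - F] and [g(X ^ n)] are both monic. *)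
pose n := (size F + \max_(k < size g) size (g`_k)%R)%N.
have gk k : (size (g`_k)%R <= n)%N.
  have [kg|gk] := ltnP k (size g); last by rewrite nth_default ?size_poly0.
  apply: leq_trans (leq_addl _ _).
  exact: (@leq_bigmax _ (fun k : 'I_(size g) => size g`_k) (Ordinal kg)).
have Q_over : g.['X^n] \is a polyOver (Rplus_pred iota).
  rewrite horner_coef; apply: rpred_sum => k _; apply: rpredM.
    by rewrite coef_map; exact: coaction_polyOver.
  by rewrite !rpredX ?polyOverX.
have Q_mon : g.['X^n] \is monic.
  rewrite horner_coef sg big_ord_recr /=.
  have -> : g`_l = 1 by rewrite -[RHS](monicP g_mon) lead_coefE.
  rewrite mul1r addrC -exprM monicE lead_coefDl ?lead_coefXn // size_polyXn ltnS.
  apply: (leq_trans (size_sum _ _ _)); apply/bigmax_leqP => k _.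
  apply: (leq_trans (size_polyMleq _ _)); rewrite -exprM size_polyXn addnS /=.
  apply: (@leq_trans (n + n * k)); first by rewrite leq_add2r.
  by rewrite -mulnS leq_mul2l ltn_ord orbT.
pose D := 'X^n - F.
have D_mon : D \is monic.
  rewrite monicE lead_coefDl ?lead_coefXn // size_polyN size_polyXn ltnS.
  exact: leq_addr.
have [q gE] := factor_theorem _ _ gF.
have [rs] := closed_field_poly_normal D.
rewrite (monicP D_mon) scale1r => DE.
have : D \is a polyOver (Rplus_pred iota).
  rewrite DE big_seq; apply: rpred_prod => z zrs; rewrite polyOverXsubC.
  apply/Rplus_predP; apply: (integral_root_monic Q_mon).
    have /rootP Dz : root D z by rewrite DE root_prod_XsubC.
    by apply/rootP; rewrite gE hornerM hornerXsubC hornerM Dz mulr0.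
  by apply/integral_poly => k; apply/Rplus_predP/polyOverP.
move=> D_over; have -> : F = 'X^n - D by rewrite opprB addrC subrK.
by apply/Rplus_predP/polyOverP; rewrite rpredB ?rpredX ?polyOverX.
Qed.

End Coaction.

(** * Degree zero parts and divisibility in the graded closure *)

Section GradedClosure.
Variables (K : fieldType) (R : idomainType) (kappa : {rmorphism K -> R}).
Variables (G : nat_grading R) (L : closedFieldType).
Variable (iota : {rmorphism {fraction R} -> L}).
Hypothesis (G_std : standard_graded kappa G).

Local Notation jL := (iota \o @tofrac R).

Let jK : {rmorphism K -> L} := jL \o kappa.

Definition GRval : {rmorphism RplusGR iota G -> L} :=
  (\val : Rplus iota -> L) \o (\val : RplusGR iota G -> Rplus iota).

Lemma GRval_inj : injective GRval.
Proof. by move=> a b ab; apply/val_inj/val_inj. Qed.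

Lemma GRval_incl r : GRval (RplusGR_incl iota G r) = jL r.
Proof. by []. Qed.

Lemma integral_over_base (A : comNzRingType) (g : {rmorphism R -> A}) (c : A) :
  integralOver (g \o kappa) c -> integralOver g c.
Proof.
case=> p p_mon pc; exists (map_poly kappa p); first by rewrite monic_map.
by rewrite -map_poly_comp.
Qed.

(** For [delta = a / N], the equation of [f] times [T ^ (a t)] is an equation of [f T ^ a] over the
    coaction: if [r_i] has degree [d = i delta], then [N d = a i]. *)
Lemma homogeneous_coaction delta (f : Rplus iota) :
  0 <= delta -> homogeneous_of_degree G delta f ->
  integralOver (coaction iota G `|denq delta|)
    (Rplus_val f *: 'X^(`|numq delta|)).
Proof.
move=> delta0 [t [r [rP rf]]].
set a := `|numq delta|%N; set N := `|denq delta|%N.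
have aN : a%:R = delta * N%:R :> rat.
  have := numqE delta; rewrite -[numq delta]gez0_abs ?numq_ge0 //.
  by rewrite -[denq delta]gez0_abs ?denq_ge0.
apply: (@integral_equation _ _ _ t r).
rewrite -[RHS](scale0r 'X^(a * t)).
have <- : Rplus_val f ^+ t +
    \sum_(1 <= i < t.+1) jL (r i) * Rplus_val f ^+ (t - i) = 0.
  rewrite -[RHS](congr1 (@Rplus_val _ _ _) rf) -[LHS]/(_ + _).
  rewrite -[RHS]/(val (_ : Rplus iota)) [RHS]rmorphD rmorphXn rmorph_sum.
  by congr (_ + _); apply: eq_bigr => i _; rewrite rmorphM rmorphXn.
rewrite scalerDl exprZn -exprM; congr (_ + _).
rewrite scaler_suml; apply: eq_big_nat => i it; have [->|[d di Gr]] := rP i it.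
  by rewrite !rmorph0 !mul0r scale0r.
rewrite (coaction_hom _ _ Gr) exprZn -scalerAl -scalerAr scalerA -exprM -exprD.
congr (_ *: 'X^_).
have -> : (N * d = a * i)%N.
  apply/eqP; rewrite -(eqr_nat rat) !natrM di aN; apply/eqP; ring.
by case/andP: it => _ it; rewrite -mulnDr subnKC.
Qed.

(** In degree 0 the coefficients lie in [R_0 = K]. Integrality over a field later makes the inverse
    of a nonzero degree zero part integral. *)
Lemma homogeneous0_integral (f : Rplus iota) :
  homogeneous_of_degree G 0 f -> integralOver jK (Rplus_val f).
Proof.
move=> [t [r [rP rf]]].
have [c cE] : exists c : nat -> K, forall i, (1 <= i <= t)%N -> kappa (c i) = r i.
  have h i : exists c, (1 <= i <= t)%N -> kappa c = r i.
    have [it|it] := boolP (1 <= i <= t)%N; last by exists 0.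
    have [->|[d]] := rP i it; first by exists 0; rewrite rmorph0.
    rewrite mulr0 => /eqP; rewrite pnatr_eq0 => /eqP -> /G_std.1[c <-].
    by exists c.
  have [c cP] := choice h; by exists c.
apply: (@integral_equation _ _ _ t c).
rewrite -[RHS](congr1 (@Rplus_val _ _ _) rf).
rewrite -[RHS]/(val (_ : Rplus iota)) [RHS]rmorphD rmorphXn rmorph_sum.
congr (_ + _); apply: eq_big_nat => i it.
by rewrite rmorphM rmorphXn /= cE.
Qed.

Variables (Kbar : fieldType) (pi : {rmorphism RplusGR iota G -> Kbar}).
Hypothesis (piP : residue_field (RplusGR_positive (iota:=iota) (G:=G)) pi).

(* The value of the lift at [T = 0] is the degree zero part of [b]. *)
Definition graded_lift (N : nat) (F : {poly L}) (k b : RplusGR iota G) :=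
  [/\ (0 < N)%N, integralOver (coaction iota G N) F, F.[1] = GRval b,
      F.[0] = GRval k & pi k = pi b /\ integralOver jK (GRval k)].

Lemma graded_lift_comp M N F k b : (0 < M)%N ->
  graded_lift N F k b -> graded_lift (M * N) (F \Po 'X^M) k b.
Proof.
move=> M0 [N0 F_int F1 F0 kP]; split=> //; first by rewrite muln_gt0 M0.
- exact: integral_coaction_comp.
- by rewrite horner_comp hornerXn expr1n.
- by rewrite horner_comp hornerXn expr0n -(prednK M0).
Qed.

(** The lift is [f T ^ a] for degree [a / N]. Its degree zero part is [f] if the degree is 0, and
    otherwise 0, as [pi] kills elements of positive degree. *)
Lemma graded_lift_homogeneous (f : RplusGR iota G) :
  homogeneous G (subring_val f) -> exists N F k, graded_lift N F k f.
Proof.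
move=> [delta delta0 hf].
exists `|denq delta|%N, (GRval f *: 'X^(`|numq delta|)).
have F_int := homogeneous_coaction delta0 hf.
have F1 : (GRval f *: 'X^(`|numq delta|)).[1] = GRval f.
  by rewrite !hornerE expr1n mulr1.
have N0 : (0 < `|denq delta|)%N by rewrite absz_gt0 denq_neq0.
have [delta_eq0|delta_neq0] := eqVneq delta 0.
  exists f; rewrite delta_eq0 in hf *; split=> //.
    by rewrite -delta_eq0.
    by rewrite -delta_eq0.
    by rewrite !hornerE.
  by split=> //; exact: homogeneous0_integral.
exists 0; split=> //.
  by rewrite !hornerE expr0n absz_eq0 numq_eq0 (negPf delta_neq0) mulr0 rmorph0.
rewrite !rmorph0; split; last exact: integral0.
apply/esym/piP.2; apply: sub_ideal_gen; exists delta => //.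
by rewrite lt_def delta_neq0.
Qed.

(** Once two lifts have a common denominator they can be subtracted and multiplied, so the liftable
    elements form a subring containing the homogeneous ones. *)
Lemma graded_lift_exists b : exists N F k, graded_lift N F k b.
Proof.
pose S : set (Rplus iota) :=
  fun z => exists b, subring_val b = z /\ exists N F k, graded_lift N F k b.
have common b1 b2 : (exists N F k, graded_lift N F k b1) ->
    (exists N F k, graded_lift N F k b2) ->
    exists N F1 F2 k1 k2, graded_lift N F1 k1 b1 /\ graded_lift N F2 k2 b2.
  move=> [N1 [F1 [k1 h1]]] [N2 [F2 [k2 h2]]].
  have [N1_gt0 _ _ _ _] := h1; have [N2_gt0 _ _ _ _] := h2.
  exists (N1 * N2)%N, (F1 \Po 'X^N2), (F2 \Po 'X^N1), k1, k2; split.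
    by rewrite mulnC; apply: graded_lift_comp.
  exact: graded_lift_comp.
have : S (subring_val b).
  case: b => z /= /subring_genP; apply; split; last first.
    move=> w hw; exists (SubringGen (introT (subring_genP _ _) (sub_subring_gen hw))).
    by split=> //; apply: graded_lift_homogeneous.
  split.
  - exists 1; split=> //; exists 1%N, 1, 1; split=> //; first exact: integral1.
    + by rewrite hornerC rmorph1.
    + by rewrite hornerC rmorph1.
    + by split=> //; rewrite rmorph1; exact: integral1.
  - move=> _ _ [b1 [<- h1]] [b2 [<- h2]]; exists (b1 - b2); split=> //.
    have [N [F1 [F2 [k1 [k2 [[N0 i1 e1 z1 [p1 l1]] [_ i2 e2 z2 [p2 l2]]]]]]]] :=
      common _ _ h1 h2.
    exists N, (F1 - F2), (k1 - k2); split=> //; first exact: integral_sub.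
    + by rewrite hornerD hornerN e1 e2 rmorphB.
    + by rewrite hornerD hornerN z1 z2 rmorphB.
    + by rewrite !rmorphB p1 p2; split=> //; exact: integral_sub.
  - move=> _ _ [b1 [<- h1]] [b2 [<- h2]]; exists (b1 * b2); split=> //.
    have [N [F1 [F2 [k1 [k2 [[N0 i1 e1 z1 [p1 l1]] [_ i2 e2 z2 [p2 l2]]]]]]]] :=
      common _ _ h1 h2.
    exists N, (F1 * F2), (k1 * k2); split=> //; first exact: integral_mul.
    + by rewrite hornerM e1 e2 rmorphM.
    + by rewrite hornerM z1 z2 rmorphM.
    + by rewrite !rmorphM p1 p2; split=> //; exact: integral_mul.
by move=> [b' [/val_inj ->]].
Qed.

Lemma RplusGR_colon (x y : R) (t : nat) (b c : RplusGR iota G) :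
  G 1%N x -> G 1%N y ->
  RplusGR_incl iota G y ^+ t * b = RplusGR_incl iota G x * c -> pi b <> 0 ->
  exists k r, y ^+ k = x * r.
Proof.
move=> Gx Gy ybxc pb.
have [N1 [F1 [k1 h1]]] := graded_lift_exists b.
have [N2 [F2 [k2 h2]]] := graded_lift_exists c.
have [N1_gt0 _ _ _ _] := h1; have [N2_gt0 _ _ _ _] := h2.
have := graded_lift_comp N1_gt0 h2; have := graded_lift_comp N2_gt0 h1.
rewrite mulnC; move: (N1 * N2)%N (F1 \Po _) (F2 \Po _).
move=> {h1 h2 N1_gt0 N2_gt0} {}N1 {}F1 {}F2.
move=> [N_gt0 i1 e1 z1 [p1 l1]] [_ i2 e2 _ _].
(* Both sides are integral over the coaction and agree at [T = 1]. *)
have YX : (jL y *: 'X^N1) ^+ t * F1 = jL x *: 'X^N1 * F2.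
  have cE r : G 1%N r -> coaction iota G N1 r = jL r *: 'X^N1.
    by move=> Gr; rewrite (coaction_hom _ _ Gr) muln1.
  apply/eqP; rewrite -subr_eq0 -!cE //; apply/eqP.
  apply: (@integral_coaction_inj _ _ _ _ N1).
    apply: integral_sub; apply: integral_mul; [|exact: i1| |exact: i2].
      by rewrite -rmorphXn; exact: (integral_id (coaction iota G N1)).
    exact: (integral_id (coaction iota G N1)).
  rewrite hornerD hornerN !hornerM horner_exp !coaction1 e1 e2.
  by rewrite -!GRval_incl -rmorphXn -!rmorphM ybxc subrr.
have k1_neq0 : GRval k1 != 0.
  by apply/eqP => k0; apply: pb; rewrite -p1 (@GRval_inj k1 0) ?rmorph0 // k0 rmorph0.
pose beta := (F2 * 'X^N1)`_(N1 * t).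
have beta_int : integralOver jL beta.
  rewrite /beta coefMXn; case: ifP => _; first exact: integral0.
  exact: integral_coaction_coef i2.
have yk : jL y ^+ t * GRval k1 = jL x * beta.
  (* As [y] lifts to [y T ^ N1], the coefficient of [T ^ (N1 * t)] on the left involves only the
     constant term of [F1], which is [k1]. *)
  have := congr1 (fun P : {poly L} => P`_(N1 * t)) YX.
  rewrite exprZn -exprM -!scalerAl !coefZ [_ * F1]mulrC coefMXn ltnn subnn.
  by rewrite -horner_coef0 z1 [_ * F2]mulrC.
have k_int : integralOver jL (GRval k1)^-1.
  by apply: integral_over_base; apply: (@integral_inv _ _ jK).
apply: (@integral_dvd_exp _ _ jL x y t (beta / GRval k1)).
- exact: frac_incl_inj.
- exact: integral_mul.
- by rewrite mulrA -yk mulfK.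
Qed.

(** The equation [z ^ (2 ^ i) - x = 0] has a single lower coefficient, of degree [2 ^ i] times
    [1 / 2 ^ i], that is 1. *)
Lemma root_homogeneous (x : R) (i : nat) (z : Rplus iota) :
  G 1%N x -> z ^+ (2 ^ i) = Rplus_incl iota x -> homogeneous G z.
Proof.
move=> Gx zx; exists (2 ^ i)%:R^-1; first by rewrite invr_ge0 ler0n.
have t0 : (0 < 2 ^ i)%N by rewrite expn_gt0.
exists (2 ^ i)%N, (fun l => if l == (2 ^ i)%N then - x else 0); split.
  move=> l _; case: eqP => [->|_]; last by left.
  right; exists 1%N; last exact: gr_opp.
  by rewrite divff // pnatr_eq0 -lt0n.
rewrite zx big_nat_recr //= eqxx subnn expr0 mulr1 rmorphN.
rewrite big_nat big1 ?add0r ?subrr // => l /andP[_ li].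
by rewrite ltn_eqF // rmorph0 mul0r.
Qed.

End GradedClosure.

Lemma graded_case (K : fieldType) (R : idomainType) (kappa : {rmorphism K -> R})
    (G : nat_grading R) (n : nat)
    (L : closedFieldType) (iota : {rmorphism {fraction R} -> L})
    (Kbar : fieldType)
    (pi : {rmorphism RplusGR iota G -> Kbar})
    (E : lmodType (RplusGR iota G)) (e : {linear restr_scalars pi -> E}) :
  standard_graded kappa G ->
  krull_dim R n -> (2 <= n)%N ->
  residue_field (RplusGR_positive (iota:=iota) (G:=G)) pi ->
  injective e -> injective_module E ->
  exists v : E,
    not_killed_by_powers (RplusGR_incl iota G) (irrelevant_ideal G) v.
Proof.
move=> G_std [[P P_chain] _] n2 piP e_inj injE.
(* Applied to the element 0, the lemma yields a degree 1 element that is not nilpotent. *)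
have [x Gx x_nil] := exists_degree1_notin_radical G_std P_chain n2 (gr_0 G 1).
have x_neq0 : x <> 0 by move=> x0; apply: (x_nil 1%N 0); rewrite x0 mulr0.
have [y Gy yx] := exists_degree1_notin_radical G_std P_chain n2 Gx.
have my : irrelevant_ideal G y.
  exists 2%N, (fun i => if i == 1%N then y else 0); split; last by rewrite big_nat1.
  by move=> i; case: eqP => [->|_] //; exact: gr_0.
pose Q (a : RplusGR iota G) := exists i, a ^+ (2 ^ i) = RplusGR_incl iota G x.
have sqrtQ a : Q a -> exists2 b, b ^+ 2 = a & Q b.
  move=> [i ai]; have [z za] := Rplus_sqrt (subring_val a).
  have zx : z ^+ (2 ^ i.+1) = Rplus_incl iota x.
    by rewrite expnS exprM za -[LHS](rmorphXn \val) ai.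
  have z_in := introT (subring_genP _ _) (sub_subring_gen (root_homogeneous Gx zx)).
  exists (SubringGen z_in); first by apply: val_inj; rewrite rmorphXn.
  by exists i.+1; apply: val_inj; rewrite rmorphXn.
have [|x_ [x_0 x_S Qx]] := iterated_sqrt sqrtQ (x := RplusGR_incl iota G x).
  by exists 0%N; rewrite expr1.
have [||v vP] := @exists_unbounded_element _ _ _ _ e e_inj injE x_
    (RplusGR_incl iota G y) x_S.
- move=> i b xb; have [l xl] := Qx i.
  apply: GRval_inj; apply/eqP; rewrite rmorph0.
  have /eqP := congr1 (@GRval _ G _ iota) xb; rewrite rmorphM rmorph0 mulf_eq0.
  case/orP => // /eqP x0; case: x_neq0; apply: (@frac_incl_inj _ _ iota).
  rewrite -(GRval_incl G) -xl rmorphXn x0 rmorph0.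
  by rewrite expr0n expn_eq0.
- move=> t b c; rewrite x_0 => ybxc; apply: contrapT => pb.
  have [k [r]] := RplusGR_colon G_std piP Gx Gy ybxc pb.
  exact: yx.
by exists v; apply: not_killed_by_powers_elt vP.
Qed.

Theorem theorem5p11 :
  (* Complete local case. [R^+] is then quasilocal, so a surjection [pi] of
     [R^+] onto a field is the residue map of [R^+]. *)
  (forall (R : idomainType) (m : set R)
      (K : fieldType) (rho : {rmorphism R -> K}) (p n : nat)
      (L : closedFieldType) (iota : {rmorphism {fraction R} -> L})
      (Kbar : closedFieldType) (j : {rmorphism K -> Kbar})
      (pi : {rmorphism Rplus iota -> Kbar})
      (E : lmodType (Rplus iota)) (e : {linear restr_scalars pi -> E}),
    noetherian_ring R -> local_ring m -> adically_complete m ->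
    residue_field m rho ->
    p \in [pchar R] -> krull_dim R n -> (2 <= n)%N ->
    algebraic_ext iota ->
    algebraic_ext j ->
    (forall y, exists x, pi x = y) ->
    (forall r, pi (Rplus_incl iota r) = j (rho r)) ->
    injective_hull e ->
    exists v : E, not_killed_by_powers (Rplus_incl iota) m v)
  /\
  (* Standard graded case. *)
  (forall (K : fieldType) (R : idomainType) (kappa : {rmorphism K -> R})
      (G : nat_grading R) (p n : nat)
      (L : closedFieldType) (iota : {rmorphism {fraction R} -> L})
      (Kbar : closedFieldType) (j : {rmorphism K -> Kbar})
      (pi : {rmorphism RplusGR iota G -> Kbar})
      (E : lmodType (RplusGR iota G)) (e : {linear restr_scalars pi -> E}),
    standard_graded kappa G ->
    p \in [pchar R] -> krull_dim R n -> (2 <= n)%N ->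
    algebraic_ext iota ->
    algebraic_ext j ->
    residue_field (RplusGR_positive (iota:=iota) (G:=G)) pi ->
    (forall c, pi (RplusGR_incl iota G (kappa c)) = j c) ->
    injective_hull e ->
    exists v : E,
      not_killed_by_powers (RplusGR_incl iota G) (irrelevant_ideal G) v).
Proof.
split.
- move=> R m K rho p n L iota Kbar j pi E e _ [[m_ideal _ _] _] m_complete rhoP _.
  move=> dimR n2 _ _ _ pi_incl [e_inj _ injE].
  exact: (complete_case m_ideal m_complete rhoP dimR n2 pi_incl e_inj injE).
- move=> K R kappa G p n L iota Kbar j pi E e G_std _ dimR n2 _ _ piP _.
  move=> [e_inj _ injE].
  exact: (graded_case G_std dimR n2 piP e_inj injE).
Qed.
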